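(* Let $(M_1,\dots,M_k)$ be a sequence of positroids on $[n]$ of consecutive ranks $\mathbf r=(r_1,\dots,r_k)$ (so $r_{i+1}=r_i+1$). Then, when considered as a sequence of positively oriented matroids, $(M_1,\dots,M_k)$ is a flag positroid if and only if it is an oriented flag matroid.
   Context: A positroid of rank $d$ on $[n]=\{1,\dots,n\}$ is a matroid realized by a real $d\times n$ matrix all of whose $d\times d$ minors are nonnegative. A sequence of matroids $(M_1,\dots,M_k)$ of ranks $r_1<\dots<r_k$ on $[n]$ is a flag positroid if there is a real $r_k\times n$ matrix $A$ such that for each $i$ the first $r_i$ rows of $A$ realize $M_i$ and all $r_i\times r_i$ minors of the first $r_i$ rows are nonnegative. Let $\mathbb S=\{-1,0,1\}$. For $f=\sum_{a\in\mathcal A}c_ax^a\in\mathbb R[x_1,\dots,x_m]$ (finite sum, $c_a\ne0$), $\chi\in\mathbb S^m$ is in the null set of $f$ if $\{\mathrm{sign}(c_a)\chi^a\}_{a\in\mathcal A}$ is either contained in $\{0\}$ or contains $\{-1,1\}$. For $r\le s$, $\mathscr P_{r,s;n}$ is the set of polynomials $\sum_{j\in J\setminus I}\mathrm{sign}(j,I,J)\,x_{I\cup j}x_{J\setminus j}$ for $I\in\binom{[n]}{r-1}$, $J\in\binom{[n]}{s+1}$, with $\mathrm{sign}(j,I,J)=(-1)^{|\{k\in J:k<j\}|+|\{i\in I:j<i\}|}$ (empty if $s=n$). An oriented matroid of rank $r$ on $[n]$ is a nonzero $\chi\in\mathbb S^{\binom{[n]}{r}}$ in the null set of every $f\in\mathscr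 P_{r,r;n}$. An oriented flag matroid of ranks $\mathbf r$ is $\boldsymbol\chi=(\chi_1,\dots,\chi_k)\in\prod_i\mathbb S^{\binom{[n]}{r_i}}$ (each $\chi_i$ nonzero) in the null set of every $f\in\bigcup_{r\le s;\ r,s\in\mathbf r}\mathscr P_{r,s;n}$. A positively oriented matroid is an oriented matroid with values only in $\{0,1\}$; a positroid $M$ is considered as the positively oriented matroid $\chi_M$ with $\chi_M(S)=1$ if $S$ is a basis and $0$ otherwise. *)

(* Defs.v *)
From mathcomp Require Import all_boot all_order all_algebra.
From mathcomp Require Import reals.
From mathcomp Require Import mpoly.

Set Implicit Arguments.
Unset Strict Implicit.
Unset Printing Implicit Defensive.

Import Order.TTheory GRing.Theory Num.Theory.
Local Open Scope ring_scope.

(* The ground set [n] is 'I_n. *)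

Record matroid (n : nat) := Matroid {
  bases : {set {set 'I_n}};
  bases_neq0 : bases != set0;
  bases_exchange : forall B C : {set 'I_n}, B \in bases -> C \in bases ->
    forall b : 'I_n, b \in B :\: C ->
    exists2 c : 'I_n, c \in C :\: B & c |: (B :\ b) \in bases
}.

(* [enum_val] lists S in increasing order, so the columns of the minor are
   taken in their natural order. *)
Definition maxminor (R : realType) (d n : nat) (A : 'M[R]_(d, n))
    (S : {set 'I_n}) (hS : #|S| = d) : R :=
  \det (colsub (fun j : 'I_d => enum_val (cast_ord (esym hS) j)) A).

Definition nonneg_maxminors (R : realType) (d n : nat) (A : 'M[R]_(d, n)) :
    Prop :=
  forall (S : {set 'I_n}) (hS : #|S| = d), 0 <= maxminor A hS.

Definition realizes (R : realType) (d n : nat) (A : 'M[R]_(d, n))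
    (M : matroid n) : Prop :=
  forall S : {set 'I_n},
    S \in bases M <-> exists hS : #|S| = d, maxminor A hS != 0.

Definition positroid (R : realType) (d n : nat) (M : matroid n) : Prop :=
  exists A : 'M[R]_(d, n), realizes A M /\ nonneg_maxminors A.

Definition first_rows (R : realType) (m n d : nat) (A : 'M[R]_(m, n))
    (h : (d <= m)%N) : 'M[R]_(d, n) :=
  rowsub (widen_ord h) A.

Definition flag_positroid (R : realType) (n k : nat) (r : 'I_k.+1 -> nat)
    (M : 'I_k.+1 -> matroid n) : Prop :=
  {homo r : i j / (i < j)%N} /\
  exists A : 'M[R]_(r ord_max, n), forall i : 'I_k.+1,
    exists h : (r i <= r ord_max)%N,
      realizes (first_rows A h) (M i) /\ nonneg_maxminors (first_rows A h).

Definition in_null_set (R : realType) (m : nat) (f : {mpoly R[m]})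
    (chi : 'I_m -> int) : Prop :=
  let V : seq int :=
    [seq sgz f@_a * \prod_(v < m) chi v ^+ a v | a <- msupp f] in
  {subset V <= [:: 0]} \/ {subset [:: -1; 1] <= V}.

(* All polynomials live in one ring with a variable x_S for every subset S of
   [n], the variables being numbered by [enum_rank]. *)
Definition xvar (R : realType) (n : nat) (S : {set 'I_n}) :
    {mpoly R[#|{set 'I_n}|]} :=
  'X_(enum_rank S).

Definition plucker_sign (R : realType) (n : nat) (j : 'I_n)
    (I J : {set 'I_n}) : R :=
  (-1) ^+ (#|[set k in J | (k < j)%N]| + #|[set i in I | (j < i)%N]|).

Definition plucker_poly (R : realType) (n : nat) (I J : {set 'I_n}) :
    {mpoly R[#|{set 'I_n}|]} :=
  \sum_(j in J :\: I)
     plucker_sign R j I J *: (xvar R (j |: I) * xvar R (J :\ j)).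

(* |I| = r - 1 is written |I| + 1 = r, so that the set is empty when r = 0. *)
Definition plucker_polys (R : realType) (r s n : nat)
    (f : {mpoly R[#|{set 'I_n}|]}) : Prop :=
  exists I J : {set 'I_n},
    [/\ #|I|.+1 = r, #|J| = s.+1 & f = plucker_poly R I J].

(* An element of {-1,0,1}^(r-subsets of [n]) is encoded as a function on all
   subsets of [n], extended by 0 to the subsets of other cardinalities. *)
Definition sign_vector (n r : nat) (chi : {set 'I_n} -> int) : Prop :=
  forall S : {set 'I_n},
    chi S \in [:: -1; 0; 1] /\ (#|S| != r -> chi S = 0).

(* The point (chi_1, ..., chi_k) assigns to x_S the value chi_i(S), where i is
   the unique index with r_i = |S|; variables of other cardinalities do not
   occur in the polynomials considered. *)
Definition flag_point (n k : nat) (r : 'I_k.+1 -> nat)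
    (chi : 'I_k.+1 -> {set 'I_n} -> int) (S : {set 'I_n}) : int :=
  if [pick i | r i == #|S|] is Some i then chi i S else 0.

Definition oriented_flag_matroid (R : realType) (n k : nat)
    (r : 'I_k.+1 -> nat) (chi : 'I_k.+1 -> {set 'I_n} -> int) : Prop :=
  [/\ {homo r : i j / (i < j)%N},
      forall i : 'I_k.+1, sign_vector (r i) (chi i),
      forall i : 'I_k.+1, exists S : {set 'I_n}, chi i S != 0
    & forall (i j : 'I_k.+1) (f : {mpoly R[#|{set 'I_n}|]}),
        (r i <= r j)%N -> plucker_polys (r i) (r j) f ->
        in_null_set f (fun v => flag_point r chi (enum_val v))].

Definition matroid_chi (n : nat) (M : matroid n) (S : {set 'I_n}) : int :=
  if S \in bases M then 1 else 0.

(* Main.v *)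
Require Import Defs.
From mathcomp Require Import all_boot all_order all_algebra.
From mathcomp Require Import reals.
From mathcomp Require Import zify ring lra.
From mathcomp Require Import -(notations) mpoly.
From mathcomp Require Import boolp topology normedtype sequences.

Set Implicit Arguments.
Unset Strict Implicit.
Unset Printing Implicit Defensive.
Import Order.TTheory GRing.Theory Num.Theory.
Import numFieldNormedType.Exports.
Local Open Scope classical_set_scope.
Local Open Scope ring_scope.

(** The minors of the initial row blocks of one matrix satisfy the incidence
    relations: for index sets I and J with |I| + 1 < |J| the signed products
    of the minor of I + j and the minor of J - j sum to zero
    ([minor_incidence]). A vanishing sum of reals has only zero terms or terms
    of both signs, so a flag positroid is an oriented flag matroid
    ([null_set_of_root]).

    For the converse, the flag is first deformed over an infinitesimal t. Give
    every basis of the flag the cost 0 and every other set the cost infinity;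
    a cost c stands for a positive number of order t ^ c. The null set
    condition says that in each incidence relation every term of finite cost
    is met by a term of the opposite sign and of the same total cost
    ([null_set_cancelling]). This property survives three constructions:
    - extending the flag down to rank 0, by contracting the last element that
      occurs in a basis of the lowest rank ([extend_flag]);
    - adding t times a column to a neighbouring column
      ([column_op_graded_flag]);
    - repeating such column operations until every set of a rank in
      the flag has a finite cost, which creates no new set of cost 0
      ([finite_costs]).

    The minimal costs w then satisfy the tropical three-term relation
    w(Xb) + w(Xac) = min (w(Xa) + w(Xbc), w(Xc) + w(Xab)) for a < b < c
    ([flag_weight]). By that relation the costs of intervals determine all
    costs, and by the relation of the same form for minors, which involves no
    subtraction, the minors of intervals determine all minors of a matrix.
    Nonzero minors of intervals can be prescribed at will
    ([interval_realization]).
    Taking them to be t ^ w makes every minor asymptotic to a positive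
    multiple of t ^ w as t tends to 0 ([deform_minors]): in the limit the
    bases keep a positive minor and the other minors vanish. The matrices
    themselves may diverge, but unitriangular row operations preserve all
    these minors and turn the entries into ratios of minors with a convergent
    denominator ([minor_normalize]); the limit of the normalized matrices
    realizes the flag ([realize_flag]). *)

(** * Positions of elements in a set *)

Definition below (n : nat) (S : {set 'I_n}) (j : 'I_n) : nat :=
  #|[set k in S | (k < j)%N]|.
Definition above (n : nat) (S : {set 'I_n}) (j : 'I_n) : nat :=
  #|[set k in S | (j < k)%N]|.

Lemma card_below_above n (S : {set 'I_n}) j :
  j \in S -> #|S| = (below S j + above S j).+1.
Proof.
move=> jS; rewrite (cardsD1 j) jS add1n; congr _.+1.
rewrite -cardsUI (_ : _ :&: _ = set0) ?cards0 ?addn0; last first.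
  by apply/setP=> k; rewrite !inE; case: ltngtP; rewrite ?andbF.
apply: eq_card => k; rewrite !inE -andb_orr andbC.
by rewrite -neq_ltn.
Qed.

(** Bridge between the sorted enumeration of a set, which indexes the columns
    of a minor, and the counts that give the signs of a Laplace expansion. *)
Lemma enum_split n (S : {set 'I_n}) (y : 'I_n) : y \in S ->
  exists l1 l2, [/\ enum S = l1 ++ y :: l2, enum (S :\ y) = l1 ++ l2,
    size l1 = below S y & size l2 = above S y].
Proof.
move=> yS.
have srt : sorted ltn (map val (enum S)).
  have := iota_ltn_sorted 0 n; rewrite -val_enum_ord.
  apply: subseq_sorted; first exact: ltn_trans.
  apply: map_subseq.
  have -> : enum S = [seq x <- enum 'I_n | x \in S] by rewrite enumT.
  exact: filter_subseq.
have yE : y \in enum S by rewrite mem_enum.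
have uE := enum_uniq S.
have [l1 [l2 eS]] : exists l1 l2, enum S = l1 ++ y :: l2.
  by case/splitPr: yE => l1 l2; exists l1, l2.
exists l1, l2.
move: srt uE; rewrite eS !map_cat /= => srt uE.
have h1 : all (fun k : 'I_n => k < y)%N l1 /\ all (fun k : 'I_n => y < k)%N l2.
  move: srt; rewrite sorted_pairwise; last exact: ltn_trans.
  rewrite pairwise_cat => /and3P[/allrelP h _ /= /andP[h2 _]].
  split; last by rewrite all_map in h2.
  by apply/allP => k k1; apply: h (map_f val k1) _; rewrite inE eqxx.
case: h1 => h1 h2.
have u1 : y \notin l1 ++ l2.
  by move: uE; rewrite -cat1s uniq_catCA /= => /andP[].
have nl1 : all (predC (fun k : 'I_n => y < k)%N) l1.
  by apply: sub_all h1 => k /=; rewrite -leqNgt => /ltnW.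
have nl2 : all (predC (fun k : 'I_n => k < y)%N) l2.
  by apply: sub_all h2 => k /=; rewrite -leqNgt => /ltnW.
have fe (T : {set 'I_n}) (P : pred 'I_n) : #|[set k in T | P k]| =
   size [seq k <- enum T | P k].
  rewrite cardE; apply/perm_size/uniq_perm.
  - exact: enum_uniq.
  - exact/filter_uniq/enum_uniq.
  by move=> k; rewrite mem_enum [RHS]mem_filter mem_enum inE andbC.
split=> //.
- rewrite [LHS](_ : _ = rem y (enum S)); last first.
    rewrite rem_filter ?enum_uniq // /enum_mem -filter_predI.
    by apply: eq_filter => k; rewrite !inE.
  rewrite eS rem_filter // filter_cat /= eqxx /=.
  by rewrite -filter_cat; apply/all_filterP/allP => k kl; apply: contraNneq u1 => <-.
- rewrite /below fe eS filter_cat /= ltnn (all_filterP h1).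
  by rewrite (eq_in_filter (a2 := pred0)) ?filter_pred0 ?cats0 // => k /(allP nl2) /negbTE.
- rewrite /above fe eS filter_cat /= ltnn (all_filterP h2).
  by rewrite (eq_in_filter (a2 := pred0)) ?filter_pred0 // => k /(allP nl1) /negbTE.
Qed.

(** * Minors and incidence relations *)

Section Minors.
Variables (R : comUnitRingType) (n : nat).
Implicit Types (A : 'I_n -> nat -> R) (I J S : {set 'I_n}).

(** Entries indexed by [nat] spare casts between the sizes of a set and of the
    set with one element more or less. *)
Definition det_fun N (f : nat -> nat -> R) : R := \det (\matrix_(i < N, k < N) f i k).

Lemma eq_det_fun N f g : (forall i k, (i < N)%N -> (k < N)%N -> f i k = g i k) ->
  det_fun N f = det_fun N g.
Proof. by move=> fg; congr (\det _); apply/matrixP => i k; rewrite !mxE fg. Qed.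

Lemma det_fun_row N f : det_fun N.+1 f =
  \sum_(k < N.+1) f N k * ((-1) ^+ (N + k) * det_fun N (fun i c => f i (bump k c))).
Proof.
rewrite /det_fun (expand_det_row _ ord_max); apply: eq_bigr => k _.
rewrite mxE /cofactor; congr (_ * (_ * \det _)).
by apply/matrixP => i c; rewrite !mxE /= /bump leqNgt ltn_ord.
Qed.

Lemma det_fun_col N f p : (p < N.+1)%N -> det_fun N.+1 f =
  \sum_(i < N.+1) f i p *
     ((-1) ^+ (i + p) * det_fun N (fun r c => f (bump i r) (bump p c))).
Proof.
move=> pN; rewrite /det_fun (expand_det_col _ (Ordinal pN)); apply: eq_bigr => i _.
rewrite mxE /cofactor; congr (_ * (_ * \det _)).
by apply/matrixP => r c; rewrite !mxE.
Qed.

(** A matrix is the function sending a column to its sequence of entries, so that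
    the minors of all its initial row blocks come from a single object. *)
Definition minor A S : R :=
  det_fun #|S| (fun i k => nth (fun=> 0) [seq A y | y <- enum S] k i).

Lemma nth_cat_bump (T : Type) (x0 y : T) l1 l2 c :
  nth x0 (l1 ++ y :: l2) (bump (size l1) c) = nth x0 (l1 ++ l2) c.
Proof.
rewrite !nth_cat /bump; case: (leqP (size l1) c) => h.
  by rewrite add1n ltnNge ltnW //= subSn.
by rewrite add0n h.
Qed.

Lemma eq_minor A B S : (forall y i, y \in S -> (i < #|S|)%N -> A y i = B y i) ->
  minor A S = minor B S.
Proof.
move=> AB; apply: eq_det_fun => i k iN kN.
have y0 : 'I_n by apply: (enum_val (Ordinal kN)).
rewrite cardE in kN.
by rewrite !(nth_map y0) // AB // -mem_enum mem_nth.
Qed.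

Lemma minor_set0 A : minor A set0 = 1.
Proof. by rewrite /minor /det_fun cards0 det_mx00. Qed.

(** Laplace expansion along the last row, indexed by the elements of J. *)
Lemma minor_row A J N : #|J| = N.+1 -> minor A J =
  \sum_(y in J) (-1) ^+ above J y * A y N * minor A (J :\ y).
Proof.
move=> cJ; rewrite {1}/minor cJ det_fun_row.
rewrite -[RHS]big_enum /=.
case: (pickP (mem J)) => [y0 y0J|J0]; last by move: cJ; rewrite (eq_card0 J0).
rewrite [RHS](big_nth y0) -cardE cJ big_mkord; apply: eq_bigr => k _.
have kJ : (k < size (enum J))%N by rewrite -cardE cJ.
rewrite (nth_map y0) // mulrA [A _ _ * _]mulrC.
set y := nth _ _ _.
have yJ : y \in J by rewrite -mem_enum mem_nth.
have [l1 [l2 [e1 e2 s1 s2]]] := enum_split yJ.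
have ek : k = size l1 :> nat.
  have := index_uniq y0 kJ (enum_uniq J).
  rewrite -/y e1 index_cat /= eqxx addn0 => <-.
  case: ifP => // yl; have := enum_uniq J; rewrite e1 -cat1s uniq_catCA /= mem_cat.
  by rewrite yl.
have cJy := card_below_above yJ.
congr (_ * _ * _).
  have -> : (N + k = (below J y).*2 + above J y)%N by lia.
  by rewrite exprD -signr_odd odd_double mul1r.
rewrite /minor; move: (cardsD1 y J); rewrite yJ add1n cJ => -[<-].
apply: eq_det_fun => i c _ _.
by rewrite e1 e2 ek !map_cat /= -{1}(size_map A) nth_cat_bump.
Qed.

(** Replacing the last row by an earlier one produces a repeated row. *)
Lemma minor_row0 A J N k : #|J| = N.+1 -> (k < N)%N ->
  \sum_(y in J) (-1) ^+ above J y * A y k * minor A (J :\ y) = 0.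
Proof.
move=> cJ kN; pose B y i := if i == N then A y k else A y i.
transitivity (minor B J).
  rewrite (minor_row B cJ); apply: eq_bigr => y yJ.
  rewrite {1}/B eqxx; congr (_ * _); apply: eq_minor => z i _.
  move: (cardsD1 y J); rewrite yJ add1n cJ => -[<-] iN.
  by rewrite /B ltn_eqF.
rewrite /minor /det_fun cJ.
apply: (determinant_alternate (i1 := widen_ord (leqnSn N) (Ordinal kN))
   (i2 := ord_max)).
  by rewrite -val_eqE /= ltn_eqF.
case: (pickP (mem J)) => [y0 y0J|J0]; last by move: cJ; rewrite (eq_card0 J0).
move=> c; rewrite !mxE /= !(nth_map y0) -?cardE ?cJ //.
by rewrite /B eqxx (ltn_eqF kN).
Qed.

(** As a function of y, the minor of I + y is up to sign one fixed linear form
    in column y: C k is the cofactor of the k-th entry of a column appended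
    to the columns of I. The form vanishes on the columns of I. *)
Lemma minor_col A I : exists C : nat -> R, C #|I| = minor A I /\
  forall y, \sum_(k < #|I|.+1) C k * A y k =
    if y \in I then 0 else (-1) ^+ above I y * minor A (y |: I).
Proof.
set N := #|I|; pose col i := nth (fun=> 0) [seq A y | y <- enum I] i.
pose C k := (-1) ^+ (k + N) * det_fun N (fun r c => col c (bump k r)).
have CE k : C k = (-1) ^+ (k + N) * det_fun N (fun r c => col c (bump k r)) by [].
exists C; split.
  rewrite CE addnn -signr_odd odd_double mul1r; apply: eq_det_fun => r c rN cN.
  by rewrite /bump leqNgt rN.
move=> y; case: ifP => yI.
  pose B c := nth (fun=> 0) (rcons [seq A y | y <- enum I] (A y)) c.
  have BN : B N = A y by rewrite /B nth_rcons size_map -cardE ltnn eqxx.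
  have Bc c : (c < N)%N -> B c = col c.
    by move=> cN; rewrite /B nth_rcons size_map -cardE cN.
  transitivity (det_fun N.+1 (fun i c => B c i)).
    rewrite (@det_fun_col _ _ N) //; apply: eq_bigr => k _.
    rewrite BN mulrC CE; congr (_ * (_ * _)); apply: eq_det_fun => r c rN cN.
    by rewrite [bump N c]/bump leqNgt cN -Bc.
  rewrite /det_fun -det_tr.
  have yE : (index y (enum I) < N.+1)%N by rewrite ltnS /N cardE index_size.
  apply: (determinant_alternate (i1 := Ordinal yE) (i2 := ord_max)).
    by rewrite -val_eqE /= ltn_eqF // /N cardE index_mem mem_enum.
  move=> k; rewrite !mxE /= BN Bc; last by rewrite /N cardE index_mem mem_enum.
  by rewrite /col (nth_map y) ?index_mem ?mem_enum // nth_index // mem_enum.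
have yU : y \in y |: I by rewrite !inE eqxx.
have [l1 [l2 [e1 e2 s1 s2]]] := enum_split yU.
have cU : #|y |: I| = N.+1 by rewrite cardsU1 yI.
have b1 : below (y |: I) y = below I y.
  by apply: eq_card => z; rewrite !inE; case: eqP => // ->; rewrite ltnn !andbF.
have a1 : above (y |: I) y = above I y.
  by apply: eq_card => z; rewrite !inE; case: eqP => // ->; rewrite ltnn !andbF.
have NE : N = (below I y + above I y)%N.
  by have := card_below_above yU; rewrite cU b1 a1 => -[].
have e3 : enum I = l1 ++ l2.
  by rewrite -e2; apply: eq_enum => z; rewrite !inE; case: eqP => // ->; rewrite yI.
rewrite /minor cU (@det_fun_col _ _ (size l1)); last first.
  by rewrite s1 b1 NE ltnS leq_addr.
rewrite big_distrr; apply: eq_bigr => k _ /=.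
rewrite e1 map_cat /= nth_cat size_map ltnn subnn /=.
rewrite [RHS]mulrCA mulrC; congr (_ * _); rewrite mulrA CE; congr (_ * _).
  by rewrite -exprD s1 b1; congr (_ ^+ _); lia.
apply: eq_det_fun => r c _ _.
by rewrite -{1}(size_map A) nth_cat_bump /col e3 map_cat.
Qed.

(** By [minor_col] the first factor is a combination of the first |I| + 1
    entries of column j; against each of these rows the sum over j vanishes by
    [minor_row0]. *)
Lemma minor_incidence A I J : (#|I|.+1 < #|J|)%N ->
  \sum_(j in J :\: I) (-1) ^+ (below J j + above I j) *
     (minor A (j |: I) * minor A (J :\ j)) = 0.
Proof.
move=> IJ; have [C [_ CE]] := minor_col A I.
case cJ : #|J| IJ => [//|N] IJ.
transitivity (\sum_(j in J) (-1) ^+ below J j *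
   (\sum_(k < #|I|.+1) C k * A j k) * minor A (J :\ j)).
  rewrite [RHS](bigID (mem I)) /= [X in X + _]big1 ?add0r; last first.
    by move=> j /= /andP[_ jI]; rewrite CE jI mulr0 mul0r.
  apply: eq_big => j; first by rewrite inE andbC.
  by rewrite inE => /andP[jI _]; rewrite CE (negbTE jI) exprD !mulrA.
transitivity (\sum_(k < #|I|.+1) (-1) ^+ N * C k *
   \sum_(j in J) (-1) ^+ above J j * A j k * minor A (J :\ j)); last first.
  by rewrite big1 // => k _; rewrite (minor_row0 _ cJ) ?mulr0 // (leq_trans (ltn_ord k)).
under [RHS]eq_bigr => k _ do rewrite big_distrr.
rewrite [RHS]exchange_big; apply: eq_bigr => j jJ /=.
rewrite mulrAC mulr_sumr; apply: eq_bigr => k _ /=.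
have -> : N = (below J j + above J j)%N.
  by have := card_below_above jJ; rewrite cJ => -[].
have := sqrr_sign R (above J j); rewrite exprD expr2 => e2.
move: ((-1) ^+ below J j) ((-1) ^+ above J j) e2 => u v e2.
by rewrite -[LHS]mul1r -e2; ring.
Qed.
End Minors.

(** * Signs of the terms of an incidence relation *)

Local Open Scope nat_scope.
Section Signs.
Variable n : nat.
Implicit Types (I J K S : {set 'I_n}) (c e j : 'I_n).

Lemma belowU1 K x j : x \notin K -> below (x |: K) j = ((x < j) + below K j)%N.
Proof.
move=> xK; rewrite /below (cardsD1 x) !inE eqxx /=; congr (_ + _)%N.
by apply: eq_card => z; rewrite !inE; case: eqP => // ->; rewrite (negbTE xK).
Qed.

Lemma aboveU1 K x j : x \notin K -> above (x |: K) j = ((j < x) + above K j)%N.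
Proof.
move=> xK; rewrite /above (cardsD1 x) !inE eqxx /=; congr (_ + _)%N.
by apply: eq_card => z; rewrite !inE; case: eqP => // ->; rewrite (negbTE xK).
Qed.

Lemma belowD1 K x j : x \in K -> below K j = ((x < j) + below (K :\ x) j)%N.
Proof. by move=> xK; rewrite -belowU1 ?setD1K // !inE eqxx. Qed.

Lemma aboveD1 K x j : x \in K -> above K j = ((j < x) + above (K :\ x) j)%N.
Proof. by move=> xK; rewrite -aboveU1 ?setD1K // !inE eqxx. Qed.

Definition adjacent c e := (e == c.+1 :> nat) || (c == e.+1 :> nat).

Lemma below_adjacent K c e : adjacent c e -> c \notin K -> e \notin K ->
  below K c = below K e.
Proof.
move=> ce cK eK; apply: eq_card => z; rewrite !inE; case: (boolP (z \in K)) => //= zK.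
have zc : z != c by apply: contraNneq cK => <-.
have ze : z != e by apply: contraNneq eK => <-.
by move: ce zc ze; rewrite /adjacent -!val_eqE /=; lia.
Qed.

Lemma above_adjacent K c e : adjacent c e -> c \notin K -> e \notin K ->
  above K c = above K e.
Proof.
move=> ce cK eK; apply: eq_card => z; rewrite !inE; case: (boolP (z \in K)) => //= zK.
have zc : z != c by apply: contraNneq cK => <-.
have ze : z != e by apply: contraNneq eK => <-.
by move: ce zc ze; rewrite /adjacent -!val_eqE /=; lia.
Qed.

(** The term of index j in the incidence relation of I and J is negative when
    [term_sign j I J] holds. *)
Definition term_sign j I J := odd (below J j + above I j).

(** The set obtained when column e is replaced by column c; used only for e in
    K and c outside K. *)
Definition shift c e K := c |: (K :\ e).

Section Adjacent.
Variables (c e : 'I_n).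
Hypothesis ce : adjacent c e.
Let sw := shift c e.

Lemma adj_lt : (c < e)%N = ~~ (e < c)%N.
Proof. by move: ce; rewrite /adjacent; lia. Qed.

Lemma adj_neq : (c == e) = false.
Proof. by apply/negbTE; move: ce; rewrite /adjacent -val_eqE /=; lia. Qed.

Lemma adj_lt_other j : j != c -> j != e ->
  ((c < j)%N = (e < j)%N) * ((j < c)%N = (j < e)%N).
Proof. by move: ce; rewrite /adjacent -!val_eqE /= => *; split; lia. Qed.

Lemma below_shift K j : e \in K -> c \notin K -> j != c -> j != e ->
  below (sw K) j = below K j.
Proof.
move=> eK cK jc je; rewrite belowU1 ?(belowD1 _ eK) ?(adj_lt_other jc je) //.
by rewrite !inE (negbTE cK) andbF.
Qed.

Lemma above_shift K j : e \in K -> c \notin K -> j != c -> j != e ->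
  above (sw K) j = above K j.
Proof.
move=> eK cK jc je; rewrite aboveU1 ?(aboveD1 _ eK) ?(adj_lt_other jc je) //.
by rewrite !inE (negbTE cK) andbF.
Qed.

Lemma below_shiftE K : e \in K -> c \notin K -> below (sw K) c = below K e.
Proof.
move=> eK cK; rewrite belowU1 ?(belowD1 _ eK) ?ltnn ?inE ?(negbTE cK) ?andbF //.
by rewrite (@below_adjacent _ c e) ?inE ?eqxx ?(negbTE cK) ?andbF.
Qed.

Lemma odd_above_shift K : e \in K -> c \notin K ->
  odd (above (sw K) e) = ~~ odd (above K c).
Proof.
move=> eK cK; rewrite aboveU1 ?(aboveD1 _ eK) ?inE ?(negbTE cK) ?andbF //.
rewrite (@above_adjacent _ c e) ?inE ?eqxx ?(negbTE cK) ?andbF // adj_lt.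
by rewrite !oddD; case: (e < c)%N; case: (odd (above _ _)).
Qed.

Lemma odd_below2 K : c \in K -> e \in K -> odd (below K e) = ~~ odd (below K c).
Proof.
move=> cK eK; rewrite (belowD1 _ cK) (belowD1 c eK).
have e' : e \in K :\ c by rewrite !inE eq_sym adj_neq eK.
have c' : c \in K :\ e by rewrite !inE adj_neq cK.
rewrite (belowD1 _ e') (belowD1 c c') !ltnn adj_lt.
rewrite (_ : K :\ c :\ e = K :\ e :\ c); last by apply/setP=> z; rewrite !inE andbCA.
rewrite (@below_adjacent _ c e) ?inE ?eqxx ?andbF //.
by rewrite !oddD; case: (e < c)%N; case: (odd (below _ _)).
Qed.

(** The sign identities from here to [term_sign_moveIJ] compare the four
    relations that occur in [column_op_graded_flag]. Elements other than c and
    e see no change when e is replaced by its neighbour c, so only the mutual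
    position of c and e matters. *)
Lemma term_sign_shiftJ j I J : e \in J -> c \notin J -> j != c -> j != e ->
  term_sign j I (sw J) = term_sign j I J.
Proof. by move=> *; rewrite /term_sign below_shift. Qed.

Lemma term_sign_shiftI j I J : e \in I -> c \notin I -> j != c -> j != e ->
  term_sign j (sw I) J = term_sign j I J.
Proof. by move=> *; rewrite /term_sign above_shift. Qed.

Lemma term_sign_both I J : c \in J -> e \in J -> c \notin I -> e \notin I ->
  term_sign e I J = ~~ term_sign c I J.
Proof.
move=> cJ eJ cI eI; rewrite /term_sign !oddD odd_below2 // (above_adjacent ce cI eI).
by rewrite addNb.
Qed.

Lemma term_sign_moveJ I J : e \in J -> c \notin J -> c \notin I -> e \notin I ->
  term_sign c I (sw J) = term_sign e I J.
Proof. by move=> *; rewrite /term_sign below_shiftE // (@above_adjacent _ c e). Qed.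

Lemma term_sign_moveI I J : e \in I -> c \notin I -> c \in J -> e \in J ->
  term_sign e (sw I) J = term_sign c I J.
Proof.
move=> eI cI cJ eJ; rewrite /term_sign !oddD odd_below2 // odd_above_shift //.
by rewrite addNb addbN negbK.
Qed.

Lemma term_sign_moveIJ I J : e \in I -> c \notin I -> e \in J -> c \notin J ->
  term_sign e (sw I) J = ~~ term_sign c I (sw J).
Proof.
move=> eI cI eJ cJ; rewrite /term_sign !oddD below_shiftE // odd_above_shift //.
by rewrite addbN.
Qed.
End Adjacent.

(** * Graded flags and column operations *)

Implicit Types G : nat -> {set 'I_n} -> bool.

(** [G x S] reads: S has a contribution of order t ^ x. The condition is the
    hyperfield version of the vanishing of the incidence relation of I and J:
    each monomial is matched by one of opposite sign and equal order. *)
Definition cancelling G I J := forall j x y, j \in J :\: I ->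
  G x (j |: I) -> G y (J :\ j) ->
  exists j' x' y', [/\ j' \in J :\: I, term_sign j' I J != term_sign j I J,
    (x' + y' = x + y)%N, G x' (j' |: I) & G y' (J :\ j')].

(** All incidence relations between ranks r <= s taken from a, ..., d. *)
Definition graded_flag a d G := forall I J,
  (a <= #|I|.+1)%N -> (#|I|.+1 < #|J|)%N -> (#|J| <= d.+1)%N -> cancelling G I J.

(** The effect on minors of adding t times column c to the adjacent column e;
    adjacency makes the new contribution occur with a positive sign. *)
Definition column_op c e G x S :=
  G x S || [&& e \in S, c \notin S, (0 < x)%N & G x.-1 (shift c e S)].

Section ColumnOp.
Variables (c e : 'I_n) (a d : nat) (G : nat -> {set 'I_n} -> bool).
Hypotheses (ce : adjacent c e) (HG : graded_flag a d G).
Let sw := shift c e.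
Let op := column_op c e G.

Lemma card_shift K : e \in K -> c \notin K -> #|sw K| = #|K|.
Proof.
by move=> eK cK; rewrite cardsU1 !inE (negbTE cK) andbF [RHS](cardsD1 e) eK.
Qed.

Lemma column_opW x S : G x S -> op x S.
Proof. by rewrite /op /column_op => ->. Qed.

Lemma column_opS x S T : e \in S -> c \notin S -> T = sw S -> G x T -> op x.+1 S.
Proof. by rewrite /op /column_op => -> -> -> /= ->; rewrite orbT. Qed.

Lemma column_opP x S : op x S ->
  G x S \/ exists x', [/\ e \in S, c \notin S, x = x'.+1 & G x' (sw S)].
Proof.
case/orP; first by left.
by case/and4P => eS cS; case: x => // x _ h; right; exists x.
Qed.

Lemma shiftU K j : e \in K -> c \notin K -> j != c -> j != e ->
  sw (j |: K) = j |: sw K.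
Proof.
move=> eK cK jc je; apply/setP => z; rewrite !inE.
by case: (z =P j) => // ->; rewrite (negbTE jc) je.
Qed.

Lemma shiftD K j : e \in K -> c \notin K -> j != c -> j != e ->
  sw (K :\ j) = sw K :\ j.
Proof.
move=> eK cK jc je; apply/setP => z; rewrite !inE.
by case: (z =P j) => // ->; rewrite (negbTE jc) !andbF.
Qed.

Lemma shiftUe K : c \notin K -> e \notin K -> sw (e |: K) = c |: K.
Proof.
move=> cK eK; apply/setP => z; rewrite !inE.
by case: (z =P e) => // ->; rewrite (negbTE eK).
Qed.

Lemma shift_Ue K : e \in K -> c \notin K -> e |: sw K = c |: K.
Proof.
move=> eK cK; apply/setP => z; rewrite !inE.
by case: (z =P e) => // ->; rewrite eK orbT.
Qed.

Lemma shift_Dc K : e \in K -> c \notin K -> sw K :\ c = K :\ e.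
Proof.
move=> eK cK; apply/setP => z; rewrite !inE.
by case: (z =P c) => // ->; rewrite (negbTE cK) andbF.
Qed.

Lemma shiftDc K : c \in K -> e \in K -> sw (K :\ c) = K :\ e.
Proof.
move=> cK eK; apply/setP => z; rewrite !inE.
by case: (z =P c) => // ->; rewrite cK andbT (adj_neq ce).
Qed.

(** Expanding the incidence relation of I and J after the operation gives the
    relations of (I, J), (shift I, J), (I, shift J) and (shift I, shift J)
    before it, weighted by powers of t. The two expansions agree up to pairs
    of opposite monomials built from I + c and J - e. Hence a monomial is
    matched inside the relation it comes from; if the match falls on a
    monomial that has been cancelled, its opposite is matched in turn inside
    the other relation that contains it. *)
Lemma column_op_graded_flag : graded_flag a d op.
Proof.
move=> I J aI IJ Jd j x y; rewrite inE => /andP[jI jJ] hU hV.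
have RIJ := HG aI IJ Jd.
have RI : e \in I -> c \notin I -> cancelling G (sw I) J.
  by move=> eI cI; apply: HG; rewrite ?card_shift.
have RJ : e \in J -> c \notin J -> cancelling G I (sw J).
  by move=> eJ cJ; apply: HG; rewrite ?card_shift.
have RB : e \in I -> c \notin I -> e \in J -> c \notin J -> cancelling G (sw I) (sw J).
  by move=> eI cI eJ cJ; apply: HG; rewrite ?card_shift.
have opI j' t : e \in I -> c \notin I -> j' != c -> j' != e ->
    G t (j' |: sw I) -> op t.+1 (j' |: I).
  move=> eI cI jc je; apply: column_opS; rewrite ?shiftU ?inE ?eI ?orbT //.
  by rewrite (negbTE cI) orbF eq_sym.
have opJ j' t : e \in J -> c \notin J -> j' != c -> j' != e ->
    G t (sw J :\ j') -> op t.+1 (J :\ j').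
  move=> eJ cJ jc je; apply: column_opS; rewrite ?shiftD ?inE ?eJ ?andbT //.
    by rewrite eq_sym.
  by rewrite (negbTE cJ) andbF.
have swJ j' : e \in J -> c \notin J -> j' \in sw J :\: I -> j' != c ->
    j' \in J :\: I /\ j' != e.
  by move=> eJ cJ; rewrite !inE => /andP[-> /orP[->//|/andP[-> ->]]].
have swI j' : e \in I -> c \notin I -> j' \in J :\: sw I -> j' != e ->
    j' \in J :\: I /\ j' != c.
  move=> eI cI; rewrite !inE !negb_or negb_and negbK => /andP[/andP[-> h] ->] je.
  by move: h; rewrite (negbTE je) /= => ->.
(* The goal for a monomial of sign b and order t. *)
pose answer (b : bool) t := exists j' x' y', [/\ j' \in J :\: I, term_sign j' I J != b,
    (x' + y' = t)%N, op x' (j' |: I) & op y' (J :\ j')].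
(* The monomial of I + c and J - e is the term c of the relation of I and
   shift J, and also the term e of the relation of shift I and J, whenever
   these shifts are possible; viaJ and viaI match it there. *)
have viaJ u v : c \notin I -> e \in J -> c \notin J -> G u (c |: I) ->
    G v (J :\ e) -> answer (term_sign c I (sw J)) (u + v).+1.
  move=> cI eJ cJ hu hv.
  have cJI : c \in sw J :\: I by rewrite !inE cI eqxx.
  have hv' : G v (sw J :\ c) by rewrite shift_Dc.
  have [j' [u' [v' [j'J sgj' <- hu' hv'']]]] := RJ eJ cJ _ _ _ cJI hu hv'.
  have jc : j' != c by apply: contraNneq sgj' => ->.
  have [j'JI je] := swJ j' eJ cJ j'J jc.
  exists j', u', v'.+1; split=> //; last exact: opJ; last exact: column_opW.
    by rewrite -(term_sign_shiftJ ce I eJ).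
  by rewrite addnS.
have viaI u v : e \in I -> c \notin I -> e \in J -> G u (c |: I) ->
    G v (J :\ e) -> answer (term_sign e (sw I) J) (u + v).+1.
  move=> eI cI eJ hu hv.
  have eJI : e \in J :\: sw I by rewrite !inE eqxx orbF eq_sym (adj_neq ce).
  have hu' : G u (e |: sw I) by rewrite shift_Ue.
  have [j' [u' [v' [j'J sgj' <- hu'' hv']]]] := RI eI cI _ _ _ eJI hu' hv.
  have je : j' != e by apply: contraNneq sgj' => ->.
  have [j'JI jc] := swI j' eI cI j'J je.
  exists j', u'.+1, v'; split=> //; last exact: column_opW; last exact: opI.
  by rewrite -(term_sign_shiftI ce J eI).
(* That monomial occurs after the operation as the term c if c is in J and
   as the term e if e is not in I. *)
have termc b u v : c \notin I -> c \in J -> e \in J -> G u (c |: I) ->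
    G v (J :\ e) -> term_sign c I J != b -> answer b (u + v).+1.
  move=> cI cJ eJ hu hv sb; exists c, u, v.+1; split=> //; last 2 first.
  - exact: column_opW.
  - apply: column_opS hv; rewrite ?inE ?eqxx ?eJ ?andbT ?shiftDc //.
    by rewrite eq_sym (adj_neq ce).
  - by rewrite inE cI.
  - by rewrite addnS.
have terme b u v : c \notin I -> e \notin I -> e \in J -> G u (c |: I) ->
    G v (J :\ e) -> term_sign e I J != b -> answer b (u + v).+1.
  move=> cI eI eJ hu hv sb; exists e, u.+1, v; split=> //; last 2 first.
  - apply: column_opS hu; rewrite ?inE ?eqxx ?(negbTE cI) ?orbF ?shiftUe //.
    by rewrite (adj_neq ce).
  - exact: column_opW.
  - by rewrite inE eI.
case: (column_opP hU) (column_opP hV) => [gU|[x' [eU cU -> gU]]] [gV|[y' [eV cV -> gV]]].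
- have jJI : j \in J :\: I by rewrite inE jI.
  have [j' [u [v [j'J sgj' <- hu hv]]]] := RIJ _ _ _ jJI gU gV.
  by exists j', u, v; split=> //; apply: column_opW.
- rewrite addnS.
  move: eV cV; rewrite !inE negb_and negbK => /andP[ej eJ] cV.
  have [jc|jc] := eqVneq j c.
    subst j; rewrite shiftDc // in gV.
    have [eI|eI] := boolP (e \in I); last by apply: terme; rewrite // (term_sign_both ce) //; case: term_sign.
    by rewrite -(term_sign_moveI ce eI) //; apply: viaI.
  rewrite eq_sym (negbTE jc) /= in cV.
  rewrite shiftD // 1?eq_sym // in gV.
  have jJI : j \in sw J :\: I by rewrite !inE jI jJ (eq_sym j e) ej orbT.
  have [j' [u [v [j'J sgj' <- hu hv]]]] := RJ eJ cV _ _ _ jJI gU gV.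
  have je : j != e by rewrite eq_sym.
  rewrite (term_sign_shiftJ ce I eJ cV jc je) in sgj'.
  have [j'c|j'c] := eqVneq j' c; last first.
    have [j'JI j'e] := swJ j' eJ cV j'J j'c.
    exists j', u, v.+1; split=> //; last exact: opJ; last exact: column_opW.
      by rewrite -(term_sign_shiftJ ce I eJ).
    by rewrite addnS.
  subst j'; have cI : c \notin I by move: j'J; rewrite !inE => /andP[].
  rewrite shift_Dc // in hv.
  have [eI|eI] := boolP (e \in I); last by apply: terme; rewrite // -(term_sign_moveJ ce).
  have := viaI _ _ eI cI eJ hu hv.
  rewrite (term_sign_moveIJ ce) //; suff -> : ~~ term_sign c I (sw J) = term_sign j I J by [].
  by move: sgj'; case: term_sign; case: term_sign.
- rewrite addSn.
  move: eU cU; rewrite !inE negb_or => eU /andP[cj cI].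
  have [ej|ej] := eqVneq e j.
    subst j; rewrite shiftUe // in gU.
    have [cJ|cJ] := boolP (c \in J).
      by apply: termc; rewrite // (term_sign_both ce) //; case: term_sign.
    by rewrite -(term_sign_moveJ ce jJ) //; apply: viaJ.
  rewrite (negbTE ej) /= in eU.
  rewrite shiftU // 1?eq_sym // in gU.
  have jJI : j \in J :\: sw I by rewrite !inE negb_or negb_and jI (eq_sym j c) cj jJ orbT.
  have [j' [u [v [j'J sgj' <- hu hv]]]] := RI eU cI _ _ _ jJI gU gV.
  have [jc je] : j != c /\ j != e by rewrite (eq_sym j c) (eq_sym j e).
  rewrite (term_sign_shiftI ce J eU cI jc je) in sgj'.
  have [j'e|j'e] := eqVneq j' e; last first.
    have [j'JI j'c] := swI j' eU cI j'J j'e.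
    exists j', u.+1, v; split=> //; last exact: column_opW; last exact: opI.
    by rewrite -(term_sign_shiftI ce J eU).
  subst j'; have eJ : e \in J by move: j'J; rewrite !inE => /andP[].
  rewrite shift_Ue // in hu.
  have [cJ|cJ] := boolP (c \in J).
    by apply: termc; rewrite // -(term_sign_moveI ce eU).
  have := viaJ _ _ cI eJ cJ hu hv.
  suff -> : term_sign c I (sw J) = term_sign j I J by [].
  by move: sgj'; rewrite (term_sign_moveIJ ce) //; case: term_sign; case: term_sign.
- move: eU cU eV cV; rewrite !inE negb_or negb_and negbK.
  move=> eU /andP[cj cI] /andP[ej eJ].
  rewrite (negbTE cj) /= => cJ.
  rewrite (negbTE ej) /= in eU.
  rewrite shiftU // 1?eq_sym // in gU.
  rewrite shiftD // 1?eq_sym // in gV.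
  have jJI : j \in sw J :\: sw I.
    by rewrite !inE negb_or negb_and jI jJ (eq_sym j c) cj (eq_sym j e) ej !orbT.
  have [j' [u [v [j'J sgj' uv hu hv]]]] := RB eU cI eJ cJ _ _ _ jJI gU gV.
  have [j'JI j'c j'e] : [/\ j' \in J :\: I, j' != c & j' != e].
    move: j'J; rewrite !inE; case: (j' =P c) => //= _; by case: (j' =P e).
  exists j', u.+1, v.+1; split; rewrite ?addnS ?addSn ?uv //.
  - by move: sgj'; rewrite !(term_sign_shiftI ce) ?(term_sign_shiftJ ce) // eq_sym.
  - exact: opI.
  - exact: opJ.
Qed.
End ColumnOp.
End Signs.
Local Open Scope ring_scope.

(** * From a flag of bases to finite costs *)

Local Open Scope nat_scope.
Section Flags.
Variable n : nat.
Implicit Types (I J K S T X : {set 'I_n}) (c e j m : 'I_n).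
Implicit Types (F : {set 'I_n} -> bool) (G : nat -> {set 'I_n} -> bool).

(** Bases have order 0 and the other sets no order at all. *)
Definition grade F x S := (x == 0) && F S.

Lemma cancelling_grade F I J : cancelling (grade F) I J <->
  forall j, j \in J :\: I -> F (j |: I) -> F (J :\ j) ->
  exists j', [/\ j' \in J :\: I, term_sign j' I J != term_sign j I J,
    F (j' |: I) & F (J :\ j')].
Proof.
split=> h j.
  move=> jJ hI hJ; have [j' [x [y [? ? ? /andP[_ ?] /andP[_ ?]]]]] := h j 0 0 jJ hI hJ.
  by exists j'.
move=> x y jJ /andP[/eqP-> hI] /andP[/eqP-> hJ].
by have [j' [? ? ? ?]] := h j jJ hI hJ; exists j', 0, 0.
Qed.

(** Adjoins as rank a the contraction by m of the part of rank a + 1. *)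
Definition lower a m F S := if #|S| == a then (m \notin S) && F (m |: S) else F S.

(** A relation whose lower rank is a becomes a relation of the original flag
    when I is replaced by I + m, and J by J + m if its rank is a as well. Only
    indices j below m occur, because m is the largest element of the bases of
    rank a + 1, so all signs change simultaneously. *)
Lemma lower_flag a d m F : a < d -> graded_flag a.+1 d (grade F) ->
  (forall S z, #|S| = a.+1 -> F S -> z \in S -> z <= m) ->
  graded_flag a d (grade (lower a m F)).
Proof.
move=> ad HF Hm I J aI IJ Jd; apply/cancelling_grade => j.
rewrite inE => /andP[jI jJ].
have cU i : i \notin I -> #|i |: I| = #|I|.+1 by move=> iI; rewrite cardsU1 iI.
have cD i : i \in J -> #|J| = #|J :\ i|.+1 by move=> iJ; rewrite (cardsD1 i) iJ.
have [aI'|Ia] := ltnP a #|I|.+1.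
  have lU i : i \notin I -> lower a m F (i |: I) = F (i |: I).
    by move=> iI; rewrite /lower cU // gtn_eqF.
  have lD i : i \in J -> lower a m F (J :\ i) = F (J :\ i).
    by move=> iJ; rewrite /lower gtn_eqF //; move: (cD i iJ); lia.
  rewrite lU // lD // => hU hV.
  have jJI : j \in J :\: I by rewrite inE jI.
  have /cancelling_grade := HF _ _ aI' IJ Jd.
  case/(_ j jJI hU hV) => j' [j'JI sgj' hU' hV']; exists j'; split=> //.
    by move: j'JI; rewrite inE => /andP[/lU ->].
  by move: j'JI; rewrite inE => /andP[_ /lD ->].
have {}Ia : #|I|.+1 = a by apply/eqP; rewrite eqn_leq Ia.
have lU i : i \notin I -> lower a m F (i |: I) = (m \notin i |: I) && F (m |: (i |: I)).
  by move=> iI; rewrite /lower cU // Ia eqxx.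
rewrite lU // => /andP[]; rewrite !inE negb_or => /andP[mj mI] hU.
have cmI : #|m |: I| = a by rewrite cardsU1 mI.
have UC i : m |: (i |: I) = i |: (m |: I) by rewrite setUCA.
have sgI i : i != m -> i <= m -> term_sign i (m |: I) J = ~~ term_sign i I J.
  move=> im ilem; rewrite /term_sign aboveU1 // ltn_neqAle ilem im andbT.
  by rewrite addnC -addnA addnC addn1 /= addnC.
have [Ja|Ja] := eqVneq #|J| a.+1.
  have lD i : i \in J -> lower a m F (J :\ i) = (m \notin J :\ i) && F (m |: (J :\ i)).
    by move=> iJ; move: (cD i iJ); rewrite /lower Ja => -[<-]; rewrite eqxx.
  rewrite lD // => /andP[]; rewrite !inE mj /= => mJ hV.
  have cmJ : #|m |: J| = a.+2 by rewrite cardsU1 mJ Ja.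
  have mD i : i != m -> m |: (J :\ i) = (m |: J) :\ i.
    move=> im; apply/setP => z; rewrite !inE; case: (z =P m) => //= ->.
    by rewrite eq_sym im.
  have /cancelling_grade h : cancelling (grade F) (m |: I) (m |: J).
    by apply: HF; rewrite ?cmI ?cmJ //.
  have [||| j' [j'JI sgj' hU' hV']] := h j.
  - by rewrite !inE negb_or eq_sym mj jI jJ orbT.
  - by rewrite -UC.
  - by rewrite -mD // eq_sym.
  move: j'JI; rewrite !inE negb_or -andbA => /and3P[j'm j'I].
  rewrite (negbTE j'm) /= => j'J.
  exists j'; split.
  - by rewrite inE j'I.
  - move: sgj'; rewrite /term_sign !belowU1 // !aboveU1 // !oddD.
    move: j'm mj; rewrite -!val_eqE /=.
    do 2 case: ltngtP => //= ?; by do 4 case: (odd _).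
  - by rewrite lU // !inE negb_or eq_sym j'm mI UC.
  - by rewrite lD // !inE negb_and mJ orbT mD.
have cJ : a.+1 < #|J| by move: Ja IJ; lia.
have lD i : i \in J -> lower a m F (J :\ i) = F (J :\ i).
  by move=> iJ; rewrite /lower gtn_eqF //; move: (cD i iJ); lia.
rewrite lD // => hV.
have /cancelling_grade h : cancelling (grade F) (m |: I) J by apply: HF; rewrite ?cmI.
have [||| j' [j'JI sgj' hU' hV']] := h j.
- by rewrite !inE negb_or eq_sym mj jI jJ.
- by rewrite -UC.
- by [].
move: j'JI; rewrite !inE negb_or -andbA => /and3P[j'm j'I j'J].
have lem i : i != m -> i \notin I -> F (i |: (m |: I)) -> i <= m.
  move=> im iI hF; apply: Hm hF _; last by rewrite !inE eqxx.
  by rewrite cardsU1 !inE negb_or im iI cmI.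
exists j'; split.
- by rewrite inE j'I.
- move: sgj'; rewrite !sgI //; last by apply: lem.
  + by case: term_sign; case: term_sign.
  + by rewrite eq_sym.
  + by apply: lem; rewrite // 1?eq_sym // -UC.
- by rewrite lU // !inE negb_or eq_sym j'm mI UC.
- by rewrite lD.
Qed.

Lemma extend_flag a d F : a <= d -> graded_flag a d (grade F) ->
  (forall k, a <= k <= d -> exists S, #|S| = k /\ F S) ->
  exists F0, [/\ graded_flag 0 d (grade F0),
    forall k, k <= d -> exists S, #|S| = k /\ F0 S &
    forall S, a <= #|S| -> F0 S = F S].
Proof.
elim: a F => [|a IHa] F ad HF Fne; first by exists F; split.
have [S0 [cS0 FS0]] := Fne a.+1 ltac:(by rewrite leqnn ad).
have [z0 z0S] : exists z, z \in S0.
  by apply/set0Pn; rewrite -card_gt0 cS0.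
pose P z := [exists S : {set 'I_n}, [&& #|S| == a.+1, F S & z \in S]].
have P0 : P z0 by apply/existsP; exists S0; rewrite cS0 eqxx FS0.
case: (@arg_maxnP _ z0 P val P0) => m /existsP[S /and3P[/eqP cS FS mS]] Pm.
have [||| F0 [HF0 F0ne F0E]] := IHa (lower a m F); first exact: ltnW.
- apply: lower_flag => // T z cT FT zT; apply: Pm.
  by apply/existsP; exists T; rewrite cT eqxx FT.
- move=> k /andP[ak kd]; have [ka|ka] := eqVneq k a.
    have cSm : #|S :\ m| = a by move: cS; rewrite (cardsD1 m) mS => -[].
    by exists (S :\ m); rewrite /lower ka cSm eqxx setD1K // FS !inE eqxx.
  have [|T [cT FT]] := Fne k; first by rewrite kd andbT ltn_neqAle eq_sym ka.
  by exists T; rewrite /lower cT (negbTE ka).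
exists F0; split=> // T aT; rewrite F0E ?(ltnW aT) //.
by rewrite /lower gtn_eqF.
Qed.

(** One column operation for every ordered pair of neighbours. *)
Definition column_step G := foldr (fun p H =>
  if adjacent p.1 p.2 then column_op p.1 p.2 H else H) G (enum {: 'I_n * 'I_n}).

Lemma column_step_flag a d G : graded_flag a d G -> graded_flag a d (column_step G).
Proof.
move=> HG; rewrite /column_step; elim: (enum _) => //= p l IHl.
by case: ifP => // pa; apply: column_op_graded_flag.
Qed.

Lemma column_step0 G S : column_step G 0 S = G 0 S.
Proof.
rewrite /column_step; elim: (enum _) => //= p l IHl.
by case: ifP => // pa; rewrite /column_op /= !andbF orbF.
Qed.

Lemma column_stepW G x S : G x S -> column_step G x S.
Proof.
move=> h; rewrite /column_step; elim: (enum _) => //= p l IHl.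
by case: ifP => // pa; apply: column_opW.
Qed.

Lemma column_stepS G c e x S : adjacent c e -> e \in S -> c \notin S ->
  G x (shift c e S) -> column_step G x.+1 S.
Proof.
move=> ce eS cS h; rewrite /column_step.
have : (c, e) \in enum {: 'I_n * 'I_n} by rewrite mem_enum.
elim: (enum _) => //= p l IHl; rewrite inE => /orP[/eqP<-|/IHl hl].
  rewrite /= ce; apply: (column_opS (T := shift c e S)) => //.
  elim: l {IHl} => //= q l IHl.
  by case: ifP => // pa; apply: column_opW.
by case: ifP => // pa; apply: column_opW.
Qed.

(** Exchanging x for y is reduced to shorter exchanges through a neighbour z
    of x in the direction of y, the order of the two exchanges depending on
    whether z belongs to S. *)
Lemma adjacent_swaps_transitive (Q : {set 'I_n} -> Prop) :
  (forall c e S, adjacent c e -> e \in S -> c \notin S -> Q S -> Q (shift c e S)) ->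
  forall S T, #|S| = #|T| -> Q S -> Q T.
Proof.
move=> Qadj.
have Qswap k : forall (x y : 'I_n) S, (x - y) + (y - x) <= k -> x \in S -> y \notin S -> Q S ->
    Q (shift y x S).
  elim: k => [|k IHk] x y S.
    move=> xy xS; have -> : y = x by apply: val_inj => /=; lia.
    by rewrite xS.
  move=> xyk xS yS QS.
  have yx : y != x by apply: contraNneq yS => ->.
  have [z [zx zyk]] : exists z : 'I_n, adjacent z x /\ (z - y) + (y - z) <= k.
    have := yx; rewrite -val_eqE neq_ltn /= => /orP[yx'|xy'].
      have zn : x.-1 < n by apply: leq_ltn_trans (ltn_ord x); exact: leq_pred.
      by exists (Ordinal zn); rewrite /adjacent /=; split; lia.
    have zn : x.+1 < n by apply: leq_ltn_trans (ltn_ord y).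
    by exists (Ordinal zn); rewrite /adjacent /=; split; lia.
  have [zy|yz] := eqVneq z y; first by subst z; apply: Qadj.
  have xz : z != x by move: zx; rewrite /adjacent -val_eqE /=; lia.
  have [zS|zS] := boolP (z \in S).
    have -> : shift y x S = shift z x (shift y z S).
      apply/setP => t; rewrite !inE; case: (t =P z) => [->|] /=.
        by rewrite xz zS orbT.
      by case: (t =P y) => //= -> _; rewrite yx.
    apply: Qadj => //; last exact: IHk.
    - by rewrite /shift !inE xS (eq_sym x z) xz orbT.
    - by rewrite /shift !inE eqxx (negbTE yz).
  have -> : shift y x S = shift y z (shift z x S).
    apply/setP => t; rewrite !inE; case: (t =P z) => [->|] //=.
    by rewrite (negbTE zS) andbF.
  apply: IHk => //; first by rewrite /shift !inE eqxx.
    by rewrite /shift !inE negb_or (eq_sym y z) yz (negbTE yS) andbF.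
  exact: Qadj.
move=> S T; move: {2}#|T :\: S|.+1 (ltnSn #|T :\: S|) => k.
elim: k S => // k IHk S; rewrite ltnS => kS cST QS.
have [/eqP TS0|] := boolP (T :\: S == set0).
  suff -> : T = S by [].
  by apply/eqP; rewrite eqEcard cST leqnn andbT -setD_eq0 TS0.
case/set0Pn => y; rewrite inE => /andP[yS yT].
have /set0Pn[x] : S :\: T != set0.
  rewrite -card_gt0 cardsD cST setIC -cardsD card_gt0; apply/set0Pn.
  by exists y; rewrite inE yS.
rewrite inE => /andP[xT xS].
apply: (IHk (shift y x S)).
- apply: leq_trans kS; apply: proper_card; apply/properP; split.
    apply/subsetP => z; rewrite !inE negb_or negb_and negbK.
    case/andP=> /andP[zy /orP[/eqP->|->->//]]; by rewrite (negbTE xT).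
  by exists y; rewrite /shift !inE ?eqxx ?yS.
- by rewrite /shift cardsU1 !inE (negbTE yS) andbF -cST [RHS](cardsD1 x) xS.
- exact: (Qswap ((x - y) + (y - x))).
Qed.

(** Every set is reached from a basis of its rank by moves to neighbours, and
    each round of column operations performs such moves. *)
Lemma finite_costs d F : graded_flag 0 d (grade F) ->
  (forall k, k <= d -> exists S, #|S| = k /\ F S) ->
  exists G, [/\ graded_flag 0 d G, forall S, #|S| <= d -> exists x, G x S &
    forall S, G 0 S = F S].
Proof.
move=> HF Fne; pose it k := iter k column_step (grade F).
have it_flag k : graded_flag 0 d (it k).
  by elim: k => //= k IHk; apply: column_step_flag.
have it0 k S : it k 0 S = F S by elim: k => //= k IHk; rewrite column_step0.
have itW k l x S : k <= l -> it k x S -> it l x S.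
  by move=> kl h; rewrite -(subnK kl); elim: (l - k) => //= m IHm; apply: column_stepW.
have reach S : exists k, #|S| <= d -> exists x, it k x S.
  have [Sd|] := leqP #|S| d; last by exists 0.
  have [T [cT FT]] := Fne _ Sd.
  suff [k [x h]] : exists k x, it k x S by exists k => _; exists x.
  apply: (adjacent_swaps_transitive (Q := fun S => exists k x, it k x S)) cT _; last first.
    by exists 0, 0; rewrite it0.
  move=> c e {FT}T ce eT cT [k [x h]]; exists k.+1, x.+1 => /=.
  apply: (@column_stepS _ e c); rewrite /shift ?inE ?eqxx //.
  - by rewrite /adjacent orbC.
  - by rewrite negb_or adj_neq /adjacent 1?orbC //= eqxx.
  - rewrite (_ : e |: _ = T) //; apply/setP => z; rewrite !inE.
    case: (z =P e) => [->|] //=; case: (z =P c) => [->|] //=.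
    by rewrite (negbTE cT).
have [k kE] := fin_all_exists reach.
exists (it (\max_S k S)); split=> // S Sd.
by have [x h] := kE S Sd; exists x; apply: itW h; apply: leq_bigmax.
Qed.

(** The tropical incidence relation of X and X + a + b + c, whose middle term
    is the negative one. *)
Definition three_term d (w : {set 'I_n} -> nat) := forall X (a b c : 'I_n),
  a < b -> b < c -> a \notin X -> b \notin X -> c \notin X -> #|X|.+2 <= d ->
  w (b |: X) + w (a |: (c |: X)) =
  minn (w (a |: X) + w (b |: (c |: X))) (w (c |: X) + w (a |: (b |: X))).

Lemma below_above_notin X j : j \notin X -> below X j + above X j = #|X|.
Proof.
move=> jX; have := card_below_above (setU11 j X).
by rewrite cardsU1 jX belowU1 // aboveU1 // ltnn => -[].
Qed.

Lemma triple_incidence X (a b c : 'I_n) (J := a |: (b |: (c |: X))) :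
  a < b -> b < c -> a \notin X -> b \notin X -> c \notin X ->
  [/\ #|J| = #|X|.+3, forall j, (j \in J :\: X) = [|| j == a, j == b | j == c],
    [/\ term_sign a X J = odd #|X|, term_sign b X J = ~~ odd #|X| &
      term_sign c X J = odd #|X|] &
    [/\ J :\ a = b |: (c |: X), J :\ b = a |: (c |: X) & J :\ c = a |: (b |: X)]].
Proof.
move=> ab bc aX bX cX.
have [ba ca cb] : [/\ b != a, c != a & c != b].
  by rewrite -!val_eqE /=; split; lia.
have [nab nac nbc] : [/\ a != b, a != c & b != c].
  by rewrite -!val_eqE /=; split; lia.
have bX1 : b \notin c |: X by rewrite !inE negb_or nbc.
have aX1 : a \notin b |: (c |: X) by rewrite !inE !negb_or nab nac.
have sgJ j : j \notin X -> term_sign j X J = odd ((a < j) + (b < j) + (c < j) + #|X|).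
  move=> jX; rewrite /term_sign !belowU1 // -addnA -addnA -[in RHS](below_above_notin jX).
  by rewrite !addnA.
split.
- by rewrite !cardsU1 aX1 bX1 cX.
- move=> j; rewrite !inE; case: (j =P a) => [->|_]; first by rewrite aX.
  case: (j =P b) => [->|_]; first by rewrite bX.
  by case: (j =P c) => [->|_]; [rewrite cX | case: (j \in X)].
- split.
  + by rewrite sgJ // ltnn ltnNge (ltnW ab) ltnNge (ltnW (ltn_trans ab bc)).
  + by rewrite sgJ // ltnn ab ltnNge (ltnW bc).
  + by rewrite sgJ // ltnn bc (ltn_trans ab bc) /= negbK.
- split; first by rewrite setU1K.
  + by rewrite /J setUCA setU1K // !inE !negb_or ba nbc.
  + by rewrite /J (setUCA [set b]) (setUCA [set a]) setU1K // !inE !negb_or ca cb.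
Qed.

(** For minimal costs the matching of monomials says that the minimum over the
    terms of an incidence relation is attained with both signs. *)
Lemma flag_weight d F : graded_flag 0 d (grade F) ->
  (forall k, k <= d -> exists S, #|S| = k /\ F S) ->
  exists w, three_term d w /\ forall S, #|S| <= d -> (w S == 0) = F S.
Proof.
move=> HF Fne; have [G [HG Gfin G0]] := finite_costs HF Fne.
have ex_w S : exists x, #|S| <= d -> G x S /\ forall y, G y S -> x <= y.
  have [Sd|] := leqP #|S| d; last by exists 0.
  by case: (ex_minnP (Gfin S Sd)) => x Gx xmin; exists x.
have [w wE] := fin_all_exists ex_w.
exists w; split; last first.
  move=> S Sd; have [Gw wmin] := wE S Sd.
  apply/eqP/idP => [w0|FS]; first by rewrite -G0 -w0.
  by apply/eqP; rewrite -leqn0 wmin // G0.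
move=> X a b c ab bc aX bX cX Xd.
have [nab nac nbc] : [/\ a != b, a != c & b != c].
  by rewrite -!val_eqE /=; split; lia.
have [cJ inJ [sga sgb sgc] [Ja Jb Jc]] := triple_incidence ab bc aX bX cX.
set J := a |: _ in cJ inJ sga sgb sgc Ja Jb Jc.
have HX : cancelling G X J by apply: HG; rewrite ?cJ.
have G1 j : j \notin X -> G (w (j |: X)) (j |: X) /\ forall y, G y (j |: X) -> w (j |: X) <= y.
  by move=> jX; apply: wE; rewrite cardsU1 jX ltnW.
have G2 i j : j \notin X -> i \notin j |: X -> G (w (i |: (j |: X))) (i |: (j |: X))
   /\ forall y, G y (i |: (j |: X)) -> w (i |: (j |: X)) <= y.
  by move=> jX iX; apply: wE; rewrite !cardsU1 jX iX.
have [Ga wa] := G1 _ aX; have [Gb wb] := G1 _ bX; have [Gc wc] := G1 _ cX.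
have [||Gbc wbc] := G2 b c; rewrite ?inE ?negb_or ?nbc //.
have [||Gac wac] := G2 a c; rewrite ?inE ?negb_or ?nac //.
have [||Gab wab] := G2 a b; rewrite ?inE ?negb_or ?nab //.
have jb : b \in J :\: X by rewrite inJ eqxx orbT.
have ja : a \in J :\: X by rewrite inJ eqxx.
have jc : c \in J :\: X by rewrite inJ eqxx !orbT.
have := HX _ _ _ ja Ga; rewrite Ja => /(_ _ Gbc) [j1 [x1 [y1 [+ + e1]]]].
rewrite inJ sga => /or3P[]/eqP->; rewrite ?sga ?sgc ?eqxx // Jb => _ /wb h1 /wac h1'.
have := HX _ _ _ jc Gc; rewrite Jc => /(_ _ Gab) [j2 [x2 [y2 [+ + e2]]]].
rewrite inJ sgc => /or3P[]/eqP->; rewrite ?sga ?sgc ?eqxx // Jb => _ /wb h2 /wac h2'.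
have := HX _ _ _ jb Gb; rewrite Jb => /(_ _ Gac) [j3 [x3 [y3 [+ + e3]]]].
rewrite inJ sgb => /or3P[]/eqP->; rewrite ?sgb ?eqxx // ?Ja ?Jc.
  by move=> _ /wa h3 /wbc h3'; move: h1 h1' h2 h2' h3 h3' e1 e2 e3; clear; lia.
by move=> _ /wc h3 /wab h3'; move: h1 h1' h2 h2' h3 h3' e1 e2 e3; clear; lia.
Qed.
End Flags.
Local Open Scope ring_scope.

(** * Null sets of the incidence polynomials *)

Section NullSets.
Variables (R : realType) (n : nat).
Local Notation N := #|{set 'I_n}|.
Implicit Types (I J S : {set 'I_n}) (p : {set 'I_n} -> R).

Lemma meval_plucker p I J :
  meval (fun v => p (enum_val v)) (plucker_poly R I J) =
  \sum_(j in J :\: I) (-1) ^+ term_sign j I J * (p (j |: I) * p (J :\ j)).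
Proof.
rewrite /plucker_poly raddf_sum /=; apply: eq_bigr => j _.
rewrite mevalZ mevalM /xvar !mevalXU !enum_rankK.
by rewrite /term_sign signr_odd.
Qed.

Lemma sgz_monomial m (c : R) (p : 'I_m -> R) (a : 'I_m -> nat) :
  sgz (c * \prod_v p v ^+ a v) = sgz c * \prod_v sgz (p v) ^+ a v.
Proof.
rewrite sgzM; congr (_ * _).
rewrite (big_morph (@sgz R) (@sgzM R) (@sgz1 R)); apply: eq_bigr => v _.
elim: (a v) => [|k IHk]; first by rewrite !expr0 sgz1.
by rewrite !exprS sgzM IHk.
Qed.

(** At a real zero of f the monomials add up to zero, hence all vanish or take
    both signs. *)
Lemma null_set_of_root m (f : mpoly m R) (p : 'I_m -> R) (chi : 'I_m -> int) :
  (forall v, chi v = sgz (p v)) -> meval p f = 0 -> in_null_set f chi.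
Proof.
move=> chiE; rewrite mevalE => f0.
pose t a := mcoeff a f * \prod_v p v ^+ (a v).
have VE : [seq sgz (mcoeff a f) * \prod_(v < m) chi v ^+ a v | a <- msupp f]
   = [seq sgz (t a) | a <- msupp f].
  apply: eq_map => a; rewrite sgz_monomial; congr (_ * _).
  by apply: eq_bigr => v _; rewrite chiE.
rewrite /in_null_set VE.
have one_sign (e : R) : (forall a, a \in msupp f -> 0 <= e * t a) ->
    forall a, a \in msupp f -> e * t a = 0.
  move=> tpos a af; have : \sum_(b <- msupp f | b \in msupp f) e * t b == 0.
    by rewrite -big_seq -mulr_sumr f0 mulr0.
  rewrite psumr_eq0 // => /allP /(_ a af); rewrite af => /eqP //.
have [/hasP[a af ta]|/hasPn tpos] := boolP (has (fun a => t a < 0) (msupp f)).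
  have [/hasP[b bf tb]|/hasPn tneg] := boolP (has (fun a => 0 < t a) (msupp f)).
    right=> x; rewrite !inE => /orP[]/eqP->.
      by apply/mapP; exists a; rewrite // ltr0_sgz.
    by apply/mapP; exists b; rewrite // gtr0_sgz.
  have := one_sign (-1) _ a af; rewrite mulN1r => h.
  move: ta; rewrite -oppr_gt0 h ?ltxx // => b bf.
  by rewrite mulN1r oppr_ge0 leNgt tneg.
left=> x /mapP[a af ->]; rewrite inE sgz_eq0 -[t a]mul1r one_sign // => b bf.
by rewrite mul1r leNgt tpos.
Qed.

(** Contrapositive: if the term j has no partner of opposite sign, then all
    terms weakly share its sign, so that the value of the polynomial at the
    0-1 point and the values of all its monomials have this sign too, against
    the null set condition. Arguing on values avoids describing which terms
    collide in the polynomial. *)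
Lemma null_set_cancelling (F : {set 'I_n} -> bool) (chi : 'I_N -> int) I J :
  (forall v, chi v = (F (enum_val v) : nat)) ->
  in_null_set (plucker_poly R I J) chi -> cancelling (grade F) I J.
Proof.
move=> chiE null; apply/cancelling_grade => j jJI hI hJ.
set f := plucker_poly R I J in null.
pose c S : R := (F S : nat)%:R; pose p (v : 'I_N) := c (enum_val v).
pose eps : R := (-1) ^+ term_sign j I J.
have eps2 : eps * eps = 1 by rewrite -expr2 sqrr_sign.
pose t a := mcoeff a f * \prod_v p v ^+ (a v).
have sgt a : sgz (mcoeff a f) * \prod_v chi v ^+ (a v) = sgz (t a).
  rewrite sgz_monomial; congr (_ * _); apply: eq_bigr => v _; rewrite chiE /p /c.
  by case: (F _); rewrite ?sgz1 ?sgz0.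
have [/existsP[i /and4P[iJI sgi hI' hJ']]|none] := boolP [exists i, [&& i \in J :\: I,
    term_sign i I J != term_sign j I J, F (i |: I) & F (J :\ i)]]; first by exists i.
have T0 i : i \in J :\: I -> 0 <= eps * ((-1) ^+ term_sign i I J * (c (i |: I) * c (J :\ i))).
  move=> iJI; rewrite /c; case FI: (F _); last by rewrite !(mul0r, mulr0).
  case FJ: (F _); last by rewrite !(mul0r, mulr0).
  move/existsPn: none => /(_ i); rewrite iJI FI FJ !andbT negbK => /eqP ->.
  by rewrite !mulr1 eps2.
have fpos : 0 < eps * meval p f.
  rewrite /f /p meval_plucker mulr_sumr (bigD1 j) //= ltr_pwDl //.
    by rewrite /c hI hJ !mulr1 eps2.
  by apply: sumr_ge0 => i /andP[iJI _]; apply: T0.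
have tneg b : 0 <= eps * t b.
  rewrite /t /f /plucker_poly raddf_sum /= mulr_suml mulr_sumr.
  apply: sumr_ge0 => i iJI; rewrite mcoeffZ /xvar -mpolyXD mcoeffX.
  case: eqP => [<-|_]; last by rewrite mulr0 mul0r mulr0.
  rewrite mulr1 -mevalX mpolyXD mevalM !mevalXU /p !enum_rankK.
  by have := T0 i iJI; rewrite /plucker_sign /term_sign signr_odd.
have [a af ta] : exists2 a, a \in msupp f & eps * t a != 0.
  apply/hasP; apply: contraT => /hasPn h; move: fpos.
  rewrite mevalE mulr_sumr big_seq big1 ?ltxx // => a /h.
  by rewrite negbK => /eqP.
case: null => [V0|Vpm].
  have := V0 (sgz (t a)) ltac:(by apply/mapP; exists a; rewrite ?sgt).
  by rewrite inE sgz_eq0 => /eqP t0; move: ta; rewrite t0 mulr0 eqxx.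
have : ((-1) ^+ (~~ term_sign j I J) : int) \in [:: -1; 1].
  by case: term_sign; rewrite /= ?expr0 ?expr1 !inE eqxx ?orbT.
move/Vpm/mapP => [b bf]; rewrite sgt => sb.
have := tneg b; rewrite /eps; case: term_sign sb => /= /esym/eqP; rewrite ?expr0 ?expr1.
  by rewrite sgz_cp0 mulN1r oppr_ge0 leNgt => ->.
by rewrite sgz_cp0 mul1r leNgt => ->.
Qed.
End NullSets.

(** * Deforming a flag over an infinitesimal *)

Section Realize.
Variables (R : realType) (n : nat).
Implicit Types (S T X : {set 'I_n}) (A : 'I_n -> nat -> R) (a k : nat).

Definition interval_set a k : {set 'I_n} := [set y : 'I_n | (a <= y < a + k)%N].

Lemma card_interval_set a k : (a + k <= n)%N -> #|interval_set a k| = k.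
Proof.
elim: k => [|k IHk] akn.
  by apply/eqP; rewrite cards_eq0; apply/eqP/setP => y; rewrite !inE; lia.
rewrite addnS in akn; pose q := Ordinal akn.
have qi : q \in interval_set a k.+1 by rewrite inE /=; lia.
rewrite (cardsD1 q) qi; congr _.+1; rewrite -[RHS]IHk ?(ltnW akn) //.
by apply: eq_card => y; rewrite !inE -val_eqE /=; lia.
Qed.

Lemma interval_setD1 a k (q : 'I_n) : q = (a + k)%N :> nat ->
  interval_set a k.+1 :\ q = interval_set a k.
Proof. by move=> qE; apply/setP => y; rewrite !inE -val_eqE /= qE; lia. Qed.

(** The minor of the interval [a, a + k] is affine in its entry of row k and
    column a + k, with slope the minor of [a, a + k[; so row k is found from
    left to right. *)
Lemma interval_row k (v : {set 'I_n} -> R) A :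
  (forall a, (a + k <= n)%N -> minor A (interval_set a k) != 0) ->
  exists u : 'I_n -> R, forall a, (a + k < n)%N ->
  \sum_(y in interval_set a k.+1) (-1) ^+ above (interval_set a k.+1) y * u y *
     minor A (interval_set a k.+1 :\ y) = v (interval_set a k.+1).
Proof.
move=> Ane.
suff /(_ n)[u uE] : forall q, exists u : 'I_n -> R, forall a, (a + k < q)%N -> (a + k < n)%N ->
  \sum_(y in interval_set a k.+1) (-1) ^+ above (interval_set a k.+1) y * u y *
     minor A (interval_set a k.+1 :\ y) = v (interval_set a k.+1).
  by exists u => a ak; apply: uE.
elim=> [|q [u IHq]]; first by exists (fun=> 0).
have [nq|qn] := leqP n q.
  by exists u => a _ akn; apply: IHq => //; apply: leq_trans akn nq.
pose z := Ordinal qn; pose a0 := (q - k)%N.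
pose S := interval_set a0 k.+1.
pose rest := \sum_(y in S :\ z) (-1) ^+ above S y * u y * minor A (S :\ y).
exists (fun y => if y == z then (v S - rest) / minor A (S :\ z) else u y) => a.
rewrite ltnS leq_eqVlt => /orP[/eqP akq|akq] akn; last first.
  rewrite -IHq //; apply: eq_bigr => y; rewrite inE => /andP[_ yak].
  by rewrite ifN // -val_eqE /=; lia.
have -> : a = a0 by rewrite /a0; lia.
have zS : z \in S by rewrite inE /a0 /=; lia.
rewrite -/S (big_setD1 z zS) /= eqxx.
have -> : above S z = 0%N.
  by apply/eqP; rewrite cards_eq0; apply/eqP/setP => y; rewrite !inE /a0 /=; lia.
have Dne : minor A (S :\ z) != 0.
  by rewrite interval_setD1 ?Ane /a0 /=; lia.
rewrite mul1r divfK //; suff -> : \sum_(y in S :\ z) (-1) ^+ above S y *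
   (if y == z then (v S - rest) / minor A (S :\ z) else u y) * minor A (S :\ y) = rest.
  by rewrite subrK.
by apply: eq_bigr => y; rewrite !inE => /andP[/negbTE-> _].
Qed.

Lemma interval_realization (v : {set 'I_n} -> R) :
  v set0 = 1 -> (forall S, v S != 0) ->
  exists A, forall a k, (a + k <= n)%N -> minor A (interval_set a k) = v (interval_set a k).
Proof.
move=> v0 vne.
suff /(_ n.+1) [A AE] : forall K, exists A, forall a k, (k < K)%N -> (a + k <= n)%N ->
    minor A (interval_set a k) = v (interval_set a k).
  by exists A => a k akn; apply: AE; rewrite // ltnS (leq_trans _ akn) // leq_addl.
elim=> [|K [A IHK]]; first by exists (fun _ _ => 0).
case: K IHK => [|k] IHK.
  exists A => a [|//] _ _; have -> : interval_set a 0 = set0.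
    by apply/setP => y; rewrite !inE; lia.
  by rewrite minor_set0.
have [|u uE] := @interval_row k v A.
  by move=> a akn; rewrite IHK.
pose B y i := if i == k then u y else A y i.
have BA S : (#|S| <= k)%N -> minor B S = minor A S.
  move=> Sk; apply: eq_minor => y i _ iS; rewrite /B ltn_eqF //.
  exact: leq_trans iS Sk.
exists B => a l; rewrite ltnS leq_eqVlt => /orP[/eqP->|lk] akn; last first.
  by rewrite BA ?IHK // card_interval_set.
rewrite (minor_row _ (card_interval_set akn)) -uE; last by rewrite -addnS.
apply: eq_bigr => y yS; rewrite /B eqxx; congr (_ * _); apply: BA.
by move: (cardsD1 y (interval_set a k.+1)); rewrite yS card_interval_set // add1n => -[<-].
Qed.

(** The incidence relation of X and X + a + b + c, with the negative term moved
    to the other side. *)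
Lemma three_term_minor A X (a b c : 'I_n) :
  (a < b)%N -> (b < c)%N -> a \notin X -> b \notin X -> c \notin X ->
  minor A (b |: X) * minor A (a |: (c |: X)) =
  minor A (a |: X) * minor A (b |: (c |: X)) +
  minor A (c |: X) * minor A (a |: (b |: X)).
Proof.
move=> ab bc aX bX cX.
have [cJ inJ [sga sgb sgc] [Ja Jb Jc]] := triple_incidence ab bc aX bX cX.
have := @minor_incidence _ _ A X (a |: (b |: (c |: X))); rewrite cJ => /(_ (leqnSn _)).
have sgE j I J : (-1) ^+ (below J j + above I j) = (-1) ^+ term_sign j I J :> R.
  by rewrite /term_sign signr_odd.
under eq_bigr do rewrite sgE.
rewrite (bigD1 a) ?inJ ?eqxx //= (bigD1 b) ?inJ ?eqxx ?orbT //=; last first.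
  by rewrite -val_eqE /=; lia.
rewrite (bigD1 c) ?inJ ?eqxx ?orbT //=; last by rewrite -!val_eqE /=; lia.
rewrite big1 ?addr0; last first.
  by move=> j /andP[/andP[/andP[]]]; rewrite inJ; do 3 case: eqP.
rewrite sga sgb sgc Ja Jb Jc; case: (odd _); rewrite /= ?expr0 ?expr1; lra.
Qed.

Local Notation h := (@harmonic R).

Lemma cvg_harmonicX k : (fun m => h m ^+ k) @ \oo --> ((k == 0)%N%:R : R).
Proof.
elim: k => [|k IHk].
  by under eq_fun do rewrite expr0; apply: cvg_cst.
under eq_fun do rewrite exprS.
rewrite (_ : _%:R = 0 * (k == 0)%N%:R); last by rewrite mul0r.
by apply: cvgM; [exact: cvg_harmonic | exact: IHk].
Qed.

(** Here t is the harmonic sequence. A set S with extreme elements x, z that is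
    not an interval misses some b between them, and the three-term relation
    for b and X = S - x - z expresses the minor of S by minors of sets
    contained in strictly shorter intervals, with no subtraction. *)
Lemma deform_minors d w : three_term d w -> w set0 = 0%N ->
  exists A : nat -> 'I_n -> nat -> R, forall S, (#|S| <= d)%N ->
    (forall m, 0 < minor (A m) S) /\
    exists2 l : R, 0 < l & (fun m => minor (A m) S / h m ^+ w S) @ \oo --> l.
Proof.
move=> w3 w0.
have hpos m k : 0 < h m ^+ k by rewrite exprn_gt0 // harmonic_gt0.
have /choice[A AE] : forall m, exists A, forall a k, (a + k <= n)%N ->
    minor A (interval_set a k) = h m ^+ w (interval_set a k).
  move=> m; apply: (@interval_realization (fun S => h m ^+ w S)).
    by rewrite w0.
  by move=> S; rewrite gt_eqF.
exists A.
suff main k a S : (a + k <= n)%N -> S \subset interval_set a k -> (#|S| <= d)%N ->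
    (forall m, 0 < minor (A m) S) /\
    exists2 l : R, 0 < l & (fun m => minor (A m) S / h m ^+ w S) @ \oo --> l.
  by move=> S; apply: (main n 0%N) => //; apply/subsetP => y _; rewrite inE /= add0n.
have base a' k' : (a' + k' <= n)%N -> (forall m, 0 < minor (A m) (interval_set a' k')) /\
    exists2 l : R, 0 < l & (fun m => minor (A m) (interval_set a' k') / h m ^+ w (interval_set a' k')) @ \oo --> l.
  move=> akn; split; first by move=> m; rewrite AE.
  exists 1 => //; under eq_fun do rewrite AE // divff ?gt_eqF //.
  exact: cvg_cst.
elim: k a S => [|k IHk] a S akn Sak Sd.
  suff -> : S = interval_set a 0 by apply: base.
  by apply/eqP; rewrite eqEsubset Sak; apply/subsetP => y; rewrite inE; lia.
have akn' : (a.+1 + k <= n)%N by lia.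
have akn2 : (a + k <= n)%N by lia.
have an : (a < n)%N by lia.
have ckn : (a + k < n)%N by lia.
pose x := Ordinal an; pose z := Ordinal ckn.
have noa T : T \subset interval_set a k.+1 -> x \notin T -> T \subset interval_set a.+1 k.
  move=> /subsetP Ta xT; apply/subsetP => y yT; have := Ta y yT.
  have : y != x by apply: contraNneq xT => <-.
  by rewrite -val_eqE !inE /=; lia.
have noc T : T \subset interval_set a k.+1 -> z \notin T -> T \subset interval_set a k.
  move=> /subsetP Ta zT; apply/subsetP => y yT; have := Ta y yT.
  have : y != z by apply: contraNneq zT => <-.
  by rewrite -val_eqE !inE /=; lia.
have [xS|xS] := boolP (x \in S); last by apply: (IHk a.+1); rewrite // noa.
have [zS|zS] := boolP (z \in S); last by apply: (IHk a); rewrite // noc.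
have [->|Sne] := eqVneq S (interval_set a k.+1); first exact: base.
have [b bi bS] : exists2 b, b \in interval_set a k.+1 & b \notin S.
  by apply/subsetPn; apply: contra Sne => h; rewrite eqEsubset Sak.
have bx : b != x by apply: contraNneq bS => ->.
have bz : b != z by apply: contraNneq bS => ->.
have [xb bzl] : (x < b)%N /\ (b < z)%N.
  by move: bi bx bz; rewrite !inE -!val_eqE /=; lia.
have xz : x != z by rewrite -val_eqE ltn_eqF // (ltn_trans xb bzl).
pose X := S :\ x :\ z.
have SE : S = x |: (z |: X).
  by rewrite /X setD1K ?setD1K // !inE eq_sym xz.
have xX : x \notin X by rewrite !inE eqxx andbF.
have zX : z \notin X by rewrite !inE eqxx.
have bX : b \notin X by rewrite !inE (negbTE bS) !andbF.
have XS : X \subset interval_set a k.+1.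
  by apply: subset_trans Sak; rewrite /X; apply/subsetP => y; rewrite !inE => /andP[_ /andP[]].
clearbody X.
have cS : #|S| = #|X|.+2.
  by rewrite {1}SE !cardsU1 !inE negb_or xz xX zX.
have xi : x \in interval_set a k.+1 by apply: (subsetP Sak).
have zi : z \in interval_set a k.+1 by apply: (subsetP Sak).
have sub i T : i \in interval_set a k.+1 -> T \subset interval_set a k.+1 -> i |: T \subset interval_set a k.+1.
  by move=> ii Ti; rewrite subUset sub1set ii.
have Xd : (#|X|.+2 <= d)%N by rewrite -cS.
have [||| Px [lx lx0 cx]] := IHk a (x |: X) => //.
- by rewrite noc ?sub // !inE negb_or eq_sym xz zX.
- by rewrite cardsU1 xX (ltnW Xd).
have [||| Pz [lz lz0 cz]] := IHk a.+1 (z |: X) => //.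
- by rewrite noa ?sub // !inE negb_or xz xX.
- by rewrite cardsU1 zX (ltnW Xd).
have [||| Pb [lb lb0 cb]] := IHk a (b |: X) => //.
- by rewrite noc ?sub // !inE negb_or eq_sym bz zX.
- by rewrite cardsU1 bX (ltnW Xd).
have [||| Pxb [lxb lxb0 cxb]] := IHk a (x |: (b |: X)) => //.
- by rewrite noc ?sub // !inE !negb_or eq_sym xz eq_sym bz zX.
- by rewrite !cardsU1 bX !inE negb_or xX eq_sym bx.
have [||| Pbz [lbz lbz0 cbz]] := IHk a.+1 (b |: (z |: X)) => //.
- by rewrite noa ?sub // !inE !negb_or xz eq_sym bx xX.
- by rewrite !cardsU1 zX !inE negb_or bX bz.
have eqw := w3 X x b z xb bzl xX bX zX Xd.
have eqm m := three_term_minor (A m) xb bzl xX bX zX.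
rewrite -SE in eqw eqm.
set wS := w S in eqw *; split.
  move=> m; rewrite -(pmulr_rgt0 _ (Pb m)) eqm.
  by rewrite addr_gt0 // mulr_gt0.
set wb := w (b |: X) in eqw cb; set wx := w (x |: X) in eqw cx.
set wz := w (z |: X) in eqw cz; set wxb := w (x |: _) in eqw cxb.
set wbz := w (b |: _) in eqw cbz.
(* By the tropical relation both exponents are nonnegative and one is zero,
   so at least one of the two positive summands survives in the limit. *)
pose d1 := (wx + wbz - (wb + wS))%N; pose d2 := (wz + wxb - (wb + wS))%N.
have le1 : (wb + wS <= wx + wbz)%N by rewrite eqw geq_minl.
have le2 : (wb + wS <= wz + wxb)%N by rewrite eqw geq_minr.
have dd : (d1 == 0%N) || (d2 == 0%N).
  by rewrite !subn_eq0 eqw !leq_min !leqnn andbT leq_total.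
exists ((lx * lbz * (d1 == 0)%N%:R + lz * lxb * (d2 == 0)%N%:R) / lb).
  rewrite divr_gt0 //.
  case/orP: dd => ->; rewrite mulr1.
    by rewrite ltr_pwDl ?mulr_gt0 // mulr_ge0 ?ler0n // ltW // mulr_gt0.
  by rewrite ltr_wpDl ?mulr_gt0 // mulr_ge0 ?ler0n // ltW // mulr_gt0.
have -> : (fun m => minor (A m) S / h m ^+ wS) = (fun m =>
    (minor (A m) (x |: X) / h m ^+ wx * (minor (A m) (b |: (z |: X)) / h m ^+ wbz) * h m ^+ d1 +
     minor (A m) (z |: X) / h m ^+ wz * (minor (A m) (x |: (b |: X)) / h m ^+ wxb) * h m ^+ d2)
    / (minor (A m) (b |: X) / h m ^+ wb)).
  apply/funext => m.
  have e1 : h m ^+ d1 = h m ^+ wx * h m ^+ wbz / (h m ^+ wb * h m ^+ wS).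
    rewrite -!exprD; apply: (@mulIf _ (h m ^+ (wb + wS))); rewrite ?gt_eqF //.
    by rewrite divfK ?gt_eqF // -exprD; rewrite subnK.
  have e2 : h m ^+ d2 = h m ^+ wz * h m ^+ wxb / (h m ^+ wb * h m ^+ wS).
    rewrite -!exprD; apply: (@mulIf _ (h m ^+ (wb + wS))); rewrite ?gt_eqF //.
    by rewrite divfK ?gt_eqF // -exprD; rewrite subnK.
  rewrite e1 e2; have := eqm m; have := Pb m.
  have := hpos m wS; have := hpos m wb; have := hpos m wx; have := hpos m wbz.
  have := hpos m wxb; have := hpos m wz.
  move: (h m ^+ wS) (h m ^+ wb) (h m ^+ wx) (h m ^+ wbz) (h m ^+ wxb) (h m ^+ wz).
  move=> hS hb hx hbz hxb hz pz pxb pbz px pb pS PPb E.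
  have -> : minor (A m) S = (minor (A m) (x |: X) * minor (A m) (b |: (z |: X)) +
      minor (A m) (z |: X) * minor (A m) (x |: (b |: X))) / minor (A m) (b |: X).
    by rewrite -E mulrC mulKf ?gt_eqF.
  field; rewrite !gt_eqF //.
apply: cvgM; last by apply: cvgV => //; rewrite gt_eqF.
by apply: cvgD; (apply: cvgM; [exact: cvgM | exact: cvg_harmonicX]).
Qed.
End Realize.

(** * The limit matrix *)

Section Limit.
Variables (R : realType) (n : nat).
Implicit Types (S T X : {set 'I_n}) (A : 'I_n -> nat -> R) (a k : nat).

(** Row j of A reduced by the preceding rows so that it vanishes on the columns
    of W j. Writing the entries as ratios of minors shows that they converge
    whenever the minors do and those of the W j stay away from 0. *)
Definition normalize (W : nat -> {set 'I_n}) A (y : 'I_n) (j : nat) : R :=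
  if y \in W j then 0
  else (-1) ^+ above (W j) y * minor A (y |: W j) / minor A (W j).

(** By [minor_col] the passage from A to its normalization is multiplication
    by a lower unitriangular matrix. *)
Lemma minor_normalize d (W : nat -> {set 'I_n}) A S :
  (forall j, (j < d)%N -> #|W j| = j /\ minor A (W j) != 0) ->
  (#|S| <= d)%N -> minor (normalize W A) S = minor A S.
Proof.
move=> HW Sd.
have /choice[C CE] : forall j, exists C : nat -> R, C #|W j| = minor A (W j) /\
  forall y, \sum_(k < #|W j|.+1) C k * A y k =
    if y \in W j then 0 else (-1) ^+ above (W j) y * minor A (y |: W j).
  by move=> j; apply: minor_col.
pose U : 'M[R]_#|S| := \matrix_(i, k) (if (k <= i)%N then C i k / minor A (W i) else 0).
have dU : \det U = 1.
  rewrite det_trig; last by apply/is_trig_mxP => i k ik; rewrite mxE leqNgt ik.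
  rewrite big1 // => i _; rewrite mxE leqnn.
  have [cW Wne] := HW i (leq_trans (ltn_ord i) Sd).
  by have [+ _] := CE i; rewrite cW => ->; rewrite divff.
rewrite -[RHS]mul1r -dU /minor /det_fun -det_mulmx; congr (\det _).
apply/matrixP => i k; rewrite !mxE.
have [y0 _] : exists y0 : 'I_n, y0 \in S.
  by apply/set0Pn; rewrite -card_gt0 (leq_ltn_trans _ (ltn_ord k)).
have kS : (k < size (enum S))%N by rewrite -cardE.
rewrite (nth_map y0) //; set y := nth _ _ _.
have [cW Wne] := HW i (leq_trans (ltn_ord i) Sd).
transitivity ((\sum_(l < i.+1) C i l * A y l) / minor A (W i)).
  have [_ /(_ y)] := CE i; rewrite cW => ->; rewrite /normalize.
  by case: ifP => // _; rewrite mul0r.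
rewrite mulr_suml (big_ord_widen #|S| (fun l => C i l * A y l / minor A (W i))) //.
rewrite big_mkcond; apply: eq_bigr => l _; rewrite !mxE (nth_map y0) // ltnS.
by case: ifP => // _; [rewrite mulrAC | rewrite mul0r].
Qed.

Lemma cvg_minor (A : nat -> 'I_n -> nat -> R) (B : 'I_n -> nat -> R) S :
  (forall y j, (j < #|S|)%N -> (fun m => A m y j) @ \oo --> B y j) ->
  (fun m => minor (A m) S) @ \oo --> minor B S.
Proof.
move=> AB; rewrite /minor /det_fun /determinant.
apply: cvg_big => [|s _]; first exact: add_continuous.
apply: cvgM; first exact: cvg_cst.
apply: cvg_big => [|i _]; first exact: mul_continuous.
have [y0 _] : exists y0 : 'I_n, y0 \in S.
  by apply/set0Pn; rewrite -card_gt0 (leq_ltn_trans _ (ltn_ord i)).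
under eq_fun do rewrite mxE (nth_map y0) -?cardE //.
by rewrite mxE (nth_map y0) -?cardE //; apply: AB.
Qed.

(** Each W j is a basis of the flag of rank j, so that the denominators of the
    normalized entries have a positive limit. *)
Lemma realize_flag d (F : {set 'I_n} -> bool) : graded_flag 0 d (grade F) ->
  (forall k, (k <= d)%N -> exists S, #|S| = k /\ F S) ->
  exists B : 'I_n -> nat -> R, forall S, (#|S| <= d)%N ->
    0 <= minor B S /\ (minor B S != 0) = F S.
Proof.
move=> HF Fne; have [w [w3 wF]] := flag_weight HF Fne.
have w0 : w finset.set0 = 0%N.
  have [S [/eqP + FS]] := Fne 0%N isT; rewrite cards_eq0 => /eqP S0.
  by apply/eqP; rewrite wF ?cards0 // -S0.
have [A HA] := deform_minors R w3 w0.
have /choice[L HL] : forall S, exists l : R, (#|S| <= d)%N ->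
    [/\ 0 <= l, (l != 0) = F S & (fun m => minor (A m) S) @ \oo --> l].
  move=> S; have [Sd|] := leqP #|S| d; last by exists 0.
  have [_ [l l0 cl]] := HA S Sd; exists (l * (w S == 0)%N%:R) => _; split.
  - by rewrite mulr_ge0 ?ler0n // ltW.
  - by rewrite mulf_eq0 (gt_eqF l0) /= pnatr_eq0 -wF //; case: (w S == 0%N).
  - under eq_fun => m do rewrite -[minor _ _](@divfK _ (@harmonic R m ^+ w S)) ?gt_eqF ?exprn_gt0 ?harmonic_gt0 //.
    by apply: cvgM; [exact: cl | exact: cvg_harmonicX].
have /choice[W HW] : forall j, exists S : {set 'I_n}, (j <= d)%N -> #|S| = j /\ F S.
  move=> j; have [/Fne[S h]|] := leqP j d; first by exists S.
  by exists finset.set0.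
pose B y j := if y \in W j then 0
  else (-1) ^+ above (W j) y * L (y |: W j) / L (W j).
exists B => S Sd; have [L0 LF cL] := HL S Sd.
suff -> : minor B S = L S by [].
have cB : (fun m => minor (normalize W (A m)) S) @ \oo --> minor B S.
  apply: cvg_minor => y j jS; have jd : (j < d)%N by apply: leq_trans jS Sd.
  have [cW FW] := HW j (ltnW jd).
  have [|_ LW cLW] := HL (W j); first by rewrite cW ltnW.
  rewrite /B /normalize; case: ifP => yW; first exact: cvg_cst.
  have [|_ _ cLy] := HL (y |: W j); first by rewrite cardsU1 yW cW.
  apply: cvgM; last by apply: cvgV => //; rewrite LW.
  by apply: cvgM; [exact: cvg_cst | exact: cLy].
have NA : (fun m => minor (normalize W (A m)) S) = (fun m => minor (A m) S).
  apply/funext => m; apply: (minor_normalize _ Sd) => j jd.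
  have [cW FW] := HW j (ltnW jd); split=> //.
  have [|Apos _] := HA (W j); first by rewrite cW ltnW.
  by rewrite gt_eqF.
rewrite NA in cB; exact: (cvg_unique _ cB cL).
Qed.
End Limit.

(** * Flag positroids and oriented flag matroids *)

Section Flags.
Variables (R : realType) (n : nat).

(** The minors of an initial row block of a matrix are those of any extension
    of its columns to sequences. *)
Lemma maxminor_minor d (A : 'M[R]_(d, n)) (B : 'I_n -> nat -> R) (S : {set 'I_n})
    (hS : #|S| = d) :
  (forall i y, A i y = B y i) -> maxminor A hS = minor B S.
Proof.
case: d / hS A => A AB; rewrite /maxminor /minor /det_fun; congr (\det _).
apply/matrixP => i j; rewrite !mxE AB.
have [y0 _] : exists y0 : 'I_n, y0 \in S.
  by apply/set0Pn; rewrite -card_gt0 (leq_ltn_trans _ (ltn_ord i)).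
by rewrite (enum_val_nth y0) /= (nth_map y0) // -cardE.
Qed.

Variables (k : nat) (r : 'I_k.+1 -> nat) (M : 'I_k.+1 -> matroid n).

Definition flag_bases (S : {set 'I_n}) : bool :=
  if [pick i | r i == #|S|] is Some i then S \in bases (M i) else false.

Lemma flag_point_bases S :
  flag_point r (fun i => matroid_chi (M i)) S = (flag_bases S : nat).
Proof.
rewrite /flag_point /flag_bases; case: pickP => // i _.
by rewrite /matroid_chi; case: ifP.
Qed.

Hypothesis r_inj : injective r.

Lemma pick_rank i (S : {set 'I_n}) : #|S| = r i -> [pick j | r j == #|S|] = Some i.
Proof.
move=> cS; case: pickP => [j /eqP|/(_ i)]; last by rewrite cS eqxx.
by rewrite cS => /r_inj ->.
Qed.

Lemma flag_basesE i (S : {set 'I_n}) : #|S| = r i -> flag_bases S = (S \in bases (M i)).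
Proof. by move=> cS; rewrite /flag_bases (pick_rank cS). Qed.

End Flags.

Lemma oriented_of_flag_positroid (R : realType) n k (r : 'I_k.+1 -> nat)
    (M : 'I_k.+1 -> matroid n) :
  flag_positroid R r M -> oriented_flag_matroid R r (fun i => matroid_chi (M i)).
Proof.
case=> rhomo [A HA].
have r_inj : injective r.
  move=> i j rij; apply: val_inj; case: (ltngtP i j) => // /rhomo; rewrite rij ltnn //.
pose B (y : 'I_n) (l : nat) := if insub l is Some i then A i y else 0.
have AB i (h : (r i <= r ord_max)%N) l y : first_rows A h l y = B y l.
  by rewrite mxE /B -[nat_of_ord l]/(val (widen_ord h l)) valK.
have base_card i (S : {set 'I_n}) : S \in bases (M i) -> #|S| = r i.
  by have [h [rA _]] := HA i; case/rA.
have sgB i (S : {set 'I_n}) : #|S| = r i -> sgz (minor B S) = (S \in bases (M i) : nat).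
  move=> cS; have [h [rA /(_ S cS)]] := HA i.
  rewrite (maxminor_minor cS (AB i h)) => pos.
  case: (boolP (S \in _)) => [/rA[hS]|Sn].
    by rewrite (maxminor_minor hS (AB i h)) => ne; rewrite gtr0_sgz // lt_def ne.
  apply/eqP; rewrite sgz_eq0; apply: contraNT Sn => ne; apply/rA; exists cS.
  by rewrite (maxminor_minor cS (AB i h)).
split=> //.
- move=> i S; split; first by rewrite /matroid_chi; case: ifP; rewrite !inE eqxx ?orbT.
  by move=> cS; rewrite /matroid_chi; case: ifP => // /base_card cS'; rewrite cS' eqxx in cS.
- move=> i; have /set0Pn[S SM] := bases_neq0 (M i); exists S.
  by rewrite /matroid_chi SM.
move=> i j f rij [I [J [cI cJ ->]]].
pose p (S : {set 'I_n}) := if flag_bases r M S then minor B S else 0.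
apply: (@null_set_of_root _ _ _ (fun v => p (enum_val v))).
  move=> v; rewrite flag_point_bases /p; case: ifP => [|_]; last by rewrite sgz0.
  rewrite /flag_bases; case: pickP => // l /eqP cS Sb.
  by rewrite (sgB l) // Sb.
rewrite meval_plucker -[RHS](minor_incidence B (I := I) (J := J)); last first.
  by rewrite cI cJ ltnS.
have pE l (S : {set 'I_n}) : #|S| = r l -> p S = minor B S.
  move=> cS; rewrite /p (flag_basesE _ r_inj cS); case: ifP => // Sn.
  by apply/esym/eqP; rewrite -sgz_eq0 (sgB l) // Sn.
apply: eq_bigr => y; rewrite inE => /andP[yI yJ].
rewrite (pE i) ?(pE j); first by rewrite /term_sign signr_odd.
- by move: (cardsD1 y J); rewrite yJ cJ => -[].
- by rewrite cardsU1 yI.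
Qed.

Lemma flag_positroid_of_oriented (R : realType) n k (r : 'I_k.+1 -> nat)
    (M : 'I_k.+1 -> matroid n) :
  (forall i j : 'I_k.+1, j = i.+1 :> nat -> r j = (r i).+1) ->
  oriented_flag_matroid R r (fun i => matroid_chi (M i)) -> flag_positroid R r M.
Proof.
move=> hr [rhomo Msv _ null].
have rE (i : 'I_k.+1) : r i = (r ord0 + i)%N.
  case: i; elim=> [|i IHi] ik; first by rewrite addn0; congr r; apply: val_inj.
  by rewrite (hr (Ordinal (ltnW ik))) //= IHi addnS.
have r_inj : injective r.
  by move=> i j; rewrite (rE i) (rE j) => /addnI; apply: val_inj.
have base_card i (S : {set 'I_n}) : S \in bases (M i) -> #|S| = r i.
  move=> SM; apply/eqP; apply: contraT => cS.
  by have [_ /(_ cS)] := Msv i S; rewrite /matroid_chi SM.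
have rk m : (r ord0 <= m <= r ord_max)%N -> exists i, r i = m.
  rewrite (rE ord_max) /= => /andP[am mk].
  exists (inord (m - r ord0)); rewrite (rE (inord _)) inordK.
    by rewrite subnKC.
  by rewrite ltnS leq_subLR.
have Hflag : graded_flag (r ord0) (r ord_max) (grade (flag_bases r M)).
  move=> I J aI IJ Jd.
  have [i ri] := rk #|I|.+1 ltac:(lia).
  have [j rj] := rk #|J|.-1 ltac:(lia).
  apply: (null_set_cancelling (R := R) (chi := fun v => flag_point r
     (fun i => matroid_chi (M i)) (enum_val v))).
    by move=> v; rewrite flag_point_bases.
  apply: (null i j); first by rewrite ri rj; lia.
  by exists I, J; split=> //; rewrite rj; lia.
have Hne m : (r ord0 <= m <= r ord_max)%N -> exists S : {set 'I_n}, #|S| = m /\ flag_bases r M S.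
  case/rk => i <-; have /set0Pn[S SM] := bases_neq0 (M i); exists S.
  by have cS := base_card i S SM; rewrite (flag_basesE _ r_inj cS).
have adle : (r ord0 <= r ord_max)%N by rewrite (rE ord_max) leq_addr.
have [F [HF Fne FE]] := extend_flag adle Hflag Hne.
have [B HB] := realize_flag R HF Fne.
split=> //; exists (\matrix_(i, y) B y i) => i.
have h : (r i <= r ord_max)%N by rewrite (rE i) (rE ord_max) leq_add2l -ltnS ltn_ord.
exists h.
have AB (l : 'I_(r i)) y : first_rows (\matrix_(i, y) B y i) h l y = B y l by rewrite !mxE.
have BE (S : {set 'I_n}) : #|S| = r i -> 0 <= minor B S /\ (minor B S != 0) = (S \in bases (M i)).
  move=> cS; have [|pos ->] := HB S; first by rewrite cS.
  split=> //; rewrite FE; last by rewrite cS (rE i) leq_addr.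
  exact: flag_basesE.
split=> [S|S hS]; last by rewrite (maxminor_minor hS AB); have [] := BE S hS.
split=> [SM|[hS]].
  have cS := base_card i S SM; exists cS; rewrite (maxminor_minor cS AB).
  by have [_ ->] := BE S cS.
by rewrite (maxminor_minor hS AB); have [_ ->] := BE S hS.
Qed.

Theorem corollary1p5 (R : realType) (n k : nat) (r : 'I_k.+1 -> nat)
    (M : 'I_k.+1 -> matroid n)
    (hM : forall i : 'I_k.+1, positroid R (r i) (M i))
    (hr : forall i j : 'I_k.+1, nat_of_ord j = (nat_of_ord i).+1 -> r j = (r i).+1) :
  flag_positroid R r M <->
  oriented_flag_matroid R r (fun i : 'I_k.+1 => matroid_chi (M i)).
Proof.
split; first exact: oriented_of_flag_positroid.
exact: flag_positroid_of_oriented.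
Qed.
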